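(* For any integers $d\ge 2$ and $k\ge 1$ there exists $n_0$ such that for all $n\ge n_0$, \[M_k(d,n)\le T\big(n,A_k(d)\big)\le\left(1-\frac1{A_k(d)}\right)\frac{n^2}{2}.\] Moreover, there is a constant $c=c(k,d)>0$ such that this remains valid if in the definition of $M_k(d,n)$ the intervals $[t_i,t_i+1]$ are replaced by the intervals $[t_i,t_i+cn^{1/d}]$.
   Context: A set $P\subseteq\mathbb{R}^d$ is separated if $\|p_1-p_2\|\ge1$ for all distinct $p_1,p_2\in P$. $M_k(d,n)$ is the largest $M$ for which there exist a separated set $S\subseteq\mathbb{R}^d$ of $n$ points and reals $1\le t_1\le\dots\le t_k$ such that at least $M$ pairs $\{p_1,p_2\}\subseteq S$ satisfy $\|p_1-p_2\|\in\bigcup_{i=1}^k[t_i,t_i+1]$. $T(n,s)$ is the number of edges of the balanced complete $s$-partite graph on $n$ vertices. For $\varepsilon>0$, a separated set $P$ is an $\varepsilon$-nearly $k$-distance set (with distances $1\le t_1<\dots<t_k$) if $\|p_1-p_2\|\in\bigcup_{i=1}^k[t_i,t_i+\varepsilon]$ for all distinct $p_1,p_2\in P$. A $j$-plane is an affine subspace of dimension $j$; the angle between a vector $v$ and a plane $\Lambda$ is the infimum of the angles between $v$ and vectors $w\in\Lambda-\Lambda$. A set $P$ is $(p,j,\alpha)$-flat (for $p\in P$) if there is a $j$-plane $\Lambda_p$ such that every vector $p-q$, $q\in P$, makes angle at most $\alpha$ with $\Lambda_p$ (by convention every $P$ is $(p,0,\alpha)$-flat). $P$ is almost $(j,\alpha)$-flat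 if $P$ is $(p,j,\alpha)$-flat for all but at most two points $p\in P$. For $0\le j\le d'$, $A_k(d',j)$ is the largest $N$ such that for every $\varepsilon,\alpha>0$ there exists an almost $(j,\alpha)$-flat $\varepsilon$-nearly $k$-distance set in $\mathbb{R}^{d'}$ of cardinality $N$; and $A_k(d):=A_k(d,d-1)$. *)

(* Defs.v *)
From HB Require Import structures.
From mathcomp Require Import all_boot all_order all_algebra.
From mathcomp Require Import boolp classical_sets reals trigo exp.
From mathcomp Require Import Rstruct.
From Stdlib Require Rdefinitions.

Set Implicit Arguments.
Unset Strict Implicit.
Unset Printing Implicit Defensive.

Import Order.TTheory GRing.Theory Num.Theory.
Local Open Scope classical_set_scope.
Local Open Scope ring_scope.

Notation RR := Rdefinitions.R.

Definition dotp (d : nat) (v w : 'rV[RR]_d) : RR := \sum_(i < d) v 0 i * w 0 i.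
Definition enorm (d : nat) (v : 'rV[RR]_d) : RR := Num.sqrt (dotp v v).
Definition edist (d : nat) (p q : 'rV[RR]_d) : RR := enorm (p - q).

Definition separated (d n : nat) (f : 'I_n -> 'rV[RR]_d) : Prop :=
  forall i j : 'I_n, i != j -> 1 <= edist (f i) (f j).

Definition good_pairs (d n k : nat) (f : 'I_n -> 'rV[RR]_d) (t : 'I_k -> RR)
  (L : RR) : nat :=
  #|[set ij : 'I_n * 'I_n | (ij.1 < ij.2)%N &&
      [exists l : 'I_k, (t l <= edist (f ij.1) (f ij.2)) &&
                        (edist (f ij.1) (f ij.2) <= t l + L)]]|.

Definition achievable (k d n : nat) (L : RR) (M : nat) : Prop :=
  exists (f : 'I_n -> 'rV[RR]_d) (t : 'I_k -> RR),
    [/\ separated f,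
        (forall l : 'I_k, 1 <= t l),
        (forall l l' : 'I_k, (l <= l')%N -> t l <= t l') &
        (M <= good_pairs f t L)%N].

(* M_k(d,n) with interval length L (L = 1 is the paper's M_k(d,n)):
   the largest achievable M; no M > C(n,2) is achievable. *)
Definition Mk (k d n : nat) (L : RR) : nat :=
  \max_(M < 'C(n, 2).+1 | `[< achievable k d n L M >]) M.

(* T(n,s): edges of the balanced complete s-partite graph on vertex set
   'I_n with parts the residue classes mod s (sizes differ by at most 1). *)
Definition Tturan (n s : nat) : nat :=
  #|[set ij : 'I_n * 'I_n | (ij.1 < ij.2)%N && (ij.1 %% s != ij.2 %% s)%N]|.

Definition vangle (d : nat) (v w : 'rV[RR]_d) : RR :=
  acos (dotp v w / (enorm v * enorm w)).

Definition jplane (d j : nat) (Lam : set 'rV[RR]_d) : Prop :=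
  exists (x0 : 'rV[RR]_d) (B : 'M[RR]_(j, d)),
    \rank B = j /\ Lam = [set x0 + u *m B | u in [set: 'rV[RR]_j]].

Definition angle_vp (d : nat) (v : 'rV[RR]_d) (Lam : set 'rV[RR]_d) : RR :=
  inf [set vangle v w | w in [set w | (exists a b, Lam a /\ Lam b /\ w = a - b)
                                      /\ w != 0]].

Definition flat_at (d N j : nat) (alpha : RR) (f : 'I_N -> 'rV[RR]_d)
  (i : 'I_N) : Prop :=
  j = 0%N \/
  exists Lam, jplane j Lam /\
    forall q : 'I_N, q != i -> angle_vp (f i - f q) Lam <= alpha.

Definition almost_flat (d N j : nat) (alpha : RR) (f : 'I_N -> 'rV[RR]_d) :
  Prop :=
  exists E : {set 'I_N}, (#|E| <= 2)%N /\
    forall i : 'I_N, i \notin E -> flat_at j alpha f i.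

Definition nearly_kdist (d N k : nat) (eps : RR) (f : 'I_N -> 'rV[RR]_d) :
  Prop :=
  separated f /\
  exists t : 'I_k -> RR,
    [/\ (forall l : 'I_k, 1 <= t l),
        (forall l l' : 'I_k, (l < l')%N -> t l < t l') &
        (forall i i' : 'I_N, i != i' ->
           exists l : 'I_k, t l <= edist (f i) (f i') <= t l + eps)].

Definition A_adm (k d' j N : nat) : Prop :=
  forall eps alpha : RR, 0 < eps -> 0 < alpha ->
    exists f : 'I_N -> 'rV[RR]_d', nearly_kdist k eps f /\ almost_flat j alpha f.

Definition is_Ak (k d' j A : nat) : Prop :=
  A_adm k d' j A /\ forall N, A_adm k d' j N -> (N <= A)%N.

(* Main.v *)
(** Let [s = A_k(d)], [x = n^(1/d)], and join two points when their distance lies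
    in one of the [k] intervals.  Separation bounds the number of points in a ball
    of radius [rho] by [(3 d rho)^d], so only a small proportion of all pairs is
    at distance below [K x].

    Vary one vertex [g_i] of a clique taken from a family of positive density,
    keeping its distances to the other vertices [q] in the same intervals.  By
    pigeonhole some replacement [y] has [a x <= |y - g_i| <= eta |g_i - q|] for
    all [q]; as the interval length is much smaller than [a x], this forces
    [y - g_i] to be nearly orthogonal to every [g_i - q], i.e. the clique is flat
    at [g_i].  After rescaling by [2 / (a x)] it is a nearly [k]-distance set.

    If all [t_l >= K x / 2] and there are more than [T(n, s)] edges, some edge lies
    in a positive proportion of the possible [(s+1)]-cliques, and varying all the
    other vertices gives an almost flat [(s+1)]-point set, with the endpoints of
    that edge as the two exceptional points.  If some [t_l0 < K x / 2], the pairs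
    at distance above [K x] do not use [t_l0] and still form a positive proportion
    of [s]-cliques; adding to such a clique the replacement of one of its vertices
    gives [s + 1] points whose only new distance takes the place of [t_l0].  Both
    contradict the maximality of [A_k(d)]. *)

Require Import Defs.
From HB Require Import structures.
From mathcomp Require Import all_boot all_order all_algebra.
From mathcomp Require Import boolp classical_sets reals trigo exp.
From mathcomp Require Import Rstruct.
From mathcomp Require Import zify ring lra.
Import Order.TTheory GRing.Theory Num.Theory.
Local Open Scope ring_scope.

Set Implicit Arguments.
Unset Strict Implicit.
Unset Printing Implicit Defensive.

(** * Counting cliques *)

Lemma card_tuple_cons (V : finType) (m : nat) (P : pred (seq V)) :
  #|[set t : m.+1.-tuple V | P t]| =
  (\sum_(x : V) #|[set t : m.-tuple V | P (x :: t)]|)%N.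
Proof.
rewrite -sum1_card (partition_big (fun t : m.+1.-tuple V => thead t) predT) //=.
apply: eq_bigr => x _; rewrite -sum1_card.
rewrite (reindex_onto (fun t : m.-tuple V => [tuple of x :: t])
  (fun t : m.+1.-tuple V => [tuple of behead t])) /=; last first.
  by move=> t /andP[_ /eqP <-]; rewrite [RHS]tuple_eta.
apply: eq_bigl => t; rewrite !inE theadE eqxx andbT /=.
by rewrite (_ : _ == t) ?andbT //; apply/eqP/val_inj.
Qed.

(** Double counting of the pairs formed by a tuple [t] and an admissible extension [x]. *)
Lemma card_extensions (V : finType) (m h : nat) (P : pred (seq V))
    (Q : V -> pred (seq V)) :
  (forall t : m.-tuple V, P t -> (h <= #|[set x | Q x t]|)%N) ->
  (h * #|[set t : m.-tuple V | P t]| <=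
   \sum_(x : V) #|[set t : m.-tuple V | P t && Q x t]|)%N.
Proof.
move=> hQ; rewrite mulnC -sum_nat_const.
under [X in (_ <= X)%N]eq_bigr do rewrite -sum1dep_card big_mkcondr /=.
rewrite exchange_big /=.
have -> : (\sum_(i in [set t : m.-tuple V | P t]) h =
           \sum_(i : m.-tuple V | P i) h)%N by apply: eq_bigl => t; rewrite inE.
apply: leq_sum => t Pt; apply: leq_trans (hQ t Pt) _.
by rewrite -big_mkcond /= sum1dep_card.
Qed.

(** Union bound: each vertex of [s] rules out at most [D] vertices of [U]. *)
Lemma card_common_neighbours (V : finType) (adj : rel V) (U : {set V})
    (D : nat) (s : seq V) :
  symmetric adj ->
  (forall v, v \in U -> #|[set w in U | ~~ adj v w]| <= D)%N ->
  all (mem U) s ->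
  (#|U| <= #|[set w in U | all (adj w) s]| + size s * D)%N.
Proof.
move=> sym hD; elim: s => [_|x s IH] /=.
  by rewrite mul0n addn0 subset_leq_card //; apply/fintype.subsetP => v; rewrite inE andbT.
case/andP=> xU /IH {}IH; rewrite mulSn addnA.
apply: leq_trans IH _; rewrite leq_add2r.
have /(leq_add (leqnn #|[set w in U | adj w x && all (adj w) s]|)) := hD x xU.
apply: leq_trans; apply: leq_trans (leq_card_setU _ _).
apply: subset_leq_card; apply/fintype.subsetP => w; rewrite !inE => /andP[-> ->].
by rewrite sym andbT; case: (adj x w).
Qed.

Definition clique (V : finType) (adj : rel V) (U : {set V}) : pred (seq V) :=
  fun s => all (mem U) s && pairwise adj s.

(** Greedy choice: the at most [N.-1] vertices already chosen leave at least [h] candidates for the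
    next one. *)
Lemma clique_count (V : finType) (adj : rel V) (U : {set V}) (D h N : nat) :
  symmetric adj ->
  (forall v, v \in U -> #|[set w in U | ~~ adj v w]| <= D)%N ->
  (h + N.-1 * D <= #|U|)%N ->
  (h ^ N <= #|[set t : N.-tuple V | clique adj U t]|)%N.
Proof.
move=> sym hD; elim: N => [_|N IH hN].
  by rewrite expn0 card_gt0; apply/set0Pn; exists [tuple]; rewrite inE.
rewrite card_tuple_cons.
have hN' : (h + N.-1 * D <= #|U|)%N.
  by apply: leq_trans hN; rewrite leq_add2l leq_mul2r leq_pred orbT.
rewrite expnS; apply: leq_trans (leq_mul (leqnn h) (IH hN')) _.
apply: leq_trans (card_extensions (Q := fun x t => (x \in U) && all (adj x) t) _) _.
  move=> t /andP[tU _]; move: hN => /=.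
  have := card_common_neighbours sym hD tU.
  by rewrite size_tuple; lia.
apply: leq_sum => x _; apply: subset_leq_card; apply/fintype.subsetP => t.
by rewrite !inE /clique /= => /and3P[/andP[-> ->] -> ->].
Qed.

Lemma pairwise_rem (V : eqType) (r : rel V) (z : V) (s : seq V) :
  pairwise r s -> pairwise r (rem z s).
Proof. exact/subseq_pairwise/rem_subseq. Qed.

(** Finds the vertex of a clique that gives way to a new vertex with at most one non-neighbour in
    the clique. *)
Lemma exists_rem_all (V : eqType) (a : pred V) (s : seq V) :
  (0 < size s)%N -> (count (fun x => ~~ a x) s <= 1)%N ->
  exists2 z, z \in s & all a (rem z s).
Proof.
elim: s => // x s IH _ /=; case ax: (a x) => /=; last first.
  rewrite add1n ltnS leqn0 => /eqP c0; exists x; rewrite ?mem_head // eqxx.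
  by rewrite -[all _ _]negbK -has_predC has_count; move: c0; rewrite /predC => ->.
case: s IH => [_ _|y s IH hc]; first by exists x; rewrite ?mem_head //= eqxx.
have [//|//|z zs hz] := IH.
case: (eqVneq x z) => [xz|nxz].
  exists x; first exact: mem_head.
  rewrite [rem _ _]/= eqxx.
  rewrite -xz in zs hz.
  by rewrite (perm_all _ (perm_to_rem zs)); apply/andP.
exists z; first by rewrite inE zs orbT.
by rewrite [rem _ _]/= (negPf nxz); apply/andP.
Qed.

(* Count the non-edges between [F] and the common neighbourhood of [J]: each vertex
   of the latter outside the set to be estimated contributes at least two. *)
Lemma many_almost_complete (V : finType) (adj : rel V) (U : {set V})
    (D h : nat) (F J : seq V) :
  symmetric adj ->
  (forall v, v \in U -> #|[set w in U | ~~ adj v w]| <= D)%N ->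
  all (mem U) F -> all (mem U) J ->
  (2 < size F)%N ->
  (2 * h + (2 * (size F + size J).-1 - 1) * D <= 2 * #|U|)%N ->
  (h <= #|[set w in U | all (adj w) J &&
                        (count (fun x => ~~ adj w x) F <= 1)]|)%N.
Proof.
move=> sym hD FU JU F2 hh.
pose Y := [set w in U | all (adj w) J].
pose Z := [set w in U | all (adj w) J & (count (fun x => ~~ adj w x) F <= 1)%N].
rewrite -/Z.
have hY := card_common_neighbours sym hD JU; rewrite -/Y in hY.
have ZY : Z \subset Y.
  by apply/fintype.subsetP => w; rewrite !inE => /and3P[-> -> _].
have upper : (\sum_(w in Y) count (fun x => ~~ adj w x) F <= size F * D)%N.
  have -> : (\sum_(w in Y) count (fun x => ~~ adj w x) F =
             \sum_(x <- F) #|[set w in Y | ~~ adj w x]|)%N.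
    under eq_bigr do rewrite -sum1_count big_mkcond /=.
    rewrite exchange_big /=; apply: eq_bigr => x _.
    rewrite -big_mkcondr /= -sum1_card; apply: eq_bigl => w.
    by rewrite !inE.
  elim: F FU {F2 hh Z ZY} => [|x F IH] /=; first by rewrite big_nil.
  case/andP=> xU /IH {}IH; rewrite big_cons mulSn leq_add //.
  apply: leq_trans (hD x xU); apply: subset_leq_card.
  by apply/fintype.subsetP => w; rewrite !inE sym => /andP[/andP[-> _] ->].
have lower : (2 * #|Y :\: Z| <= \sum_(w in Y) count (fun x => ~~ adj w x) F)%N.
  rewrite mulnC -sum_nat_const [X in (_ <= X)%N](big_setID Z) /=.
  apply: (leq_trans _ (leq_addl _ _)).
  by apply: leq_sum => w; rewrite !inE; case: (w \in U) => //=; case: (all _ _) => //=;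
    rewrite ?andbF ?andbT // -ltnNge.
have := cardsID Z Y; rewrite (finset.setIidPr ZY).
(* With [f] and [j] the sizes of [F] and [J], the hypothesis leaves room for [(2 f + 2 j - 3) D],
   while the count costs [(f + 2 j) D]; three vertices in [F] make this enough. *)
have f3 : (3 * D <= size F * D)%N by rewrite leq_mul2r F2 orbT.
have e : ((2 * (size F + size J).-1 - 1) * D =
  2 * (size F * D) + 2 * (size J * D) - 3 * D)%N.
  by rewrite !mulnA -mulnDl -mulnBl; congr (_ * _)%N; lia.
rewrite e in hh; move: (size F * D)%N (size J * D)%N hh hY lower upper f3.
move: (\sum_(_ in _) _)%N => S a b; lia.
Qed.

Lemma clique_catC (V : finType) (adj : rel V) (U : {set V}) (s1 s2 : seq V) :
  symmetric adj -> clique adj U (s1 ++ s2) = clique adj U (s2 ++ s1).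
Proof.
move=> sym; rewrite /clique !all_cat !pairwise_cat [in RHS]allrelC.
have -> : allrel (fun y x => adj x y) s1 s2 = allrel adj s1 s2.
  by apply: eq_allrel => x y; rewrite sym.
by case: (all _ s1); case: (all _ s2); case: allrel; case: (pairwise _ s1);
  rewrite ?andbF ?andbT.
Qed.

Lemma card_set_has (T V : finType) (R : V -> pred T) (s : seq V) :
  (#|[set t | has (fun z => R z t) s]| <= \sum_(z <- s) #|[set t | R z t]|)%N.
Proof.
elim: s => [|z s IH]; first by rewrite big_nil leqn0 cards_eq0; apply/eqP/setP => t; rewrite !inE.
rewrite big_cons; apply: leq_trans (leq_add (leqnn _) IH).
apply: leq_trans (leq_card_setU _ _); apply: subset_leq_card.
by apply/fintype.subsetP => t; rewrite !inE.
Qed.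

Lemma pigeonhole_sum (V : eqType) (W : V -> nat) (c : nat) (s : seq V) :
  (0 < size s)%N -> (c <= \sum_(z <- s) W z)%N ->
  exists2 z, z \in s & (c <= size s * W z)%N.
Proof.
case: (posnP c) => [-> s0 _|c0 s0 hc].
  by case: s s0 => // z s _; exists z; rewrite ?mem_head.
apply/hasP; apply/negPn/negP; rewrite -all_predC => /allP hall.
have {}hall z : z \in s -> (size s * W z <= c.-1)%N.
  by move=> /hall /=; rewrite -ltnNge; lia.
have : (\sum_(z <- s) size s * W z <= \sum_(z <- s) c.-1)%N.
  by rewrite !big_seq; apply: leq_sum => z /hall.
rewrite -big_distrr /= big_const_seq count_predT iter_addn_0 mulnC leq_mul2r.
by case: (size s) s0 => //= _ _; lia.
Qed.

(* Starting from one clique [F] on [s.+1] vertices, each step trades a vertex of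
   [F] for many choices of a new one; at [j = s.-1] an edge lying in many cliques
   is left. *)
Lemma cliques_on_subclique (V : finType) (adj : rel V) (U : {set V}) (D h s j : nat) :
  symmetric adj ->
  (forall v, v \in U -> #|[set w in U | ~~ adj v w]| <= D)%N ->
  (2 * h + (2 * s - 1) * D <= 2 * #|U|)%N ->
  (j < s)%N ->
  (exists F : seq V, size F = s.+1 /\ clique adj U F) ->
  exists F : seq V, [/\ size F = (s.+1 - j)%N, clique adj U F &
    (h ^ j <= s.+1 ^ j * #|[set t : j.-tuple V | clique adj U (t ++ F)]|)%N].
Proof.
move=> sym hD hh js [F0 [sF0 cF0]]; elim: j js => [_|j IH js].
  exists F0; split; rewrite ?subn0 // !expn0 mul1n card_gt0.
  by apply/set0Pn; exists [tuple]; rewrite inE.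
have [F [sF /andP[FU Fadj] hF]] := IH (ltnW js).
pose Q z (x : V) (t : seq V) := clique adj U ((x :: t) ++ rem z F).
(* Each new vertex [x] from [many_almost_complete] extends [t] after dropping some [z] from [F];
   hence the sum over [z]. *)
have main : (h * #|[set t : j.-tuple V | clique adj U (t ++ F)]| <=
  \sum_(z <- F) #|[set t : j.+1.-tuple V | clique adj U (t ++ rem z F)]|)%N.
  apply: leq_trans (card_extensions
    (P := fun t => clique adj U (t ++ F)) (Q := fun x t => has (fun z => Q z x t) F) _) _.
    move=> t /andP[]; rewrite all_cat pairwise_cat => /andP[tU _] /and3P[tF tt _].
    apply: leq_trans (many_almost_complete (F := F) sym hD FU tU _ _) _.
    - by rewrite sF; lia.
    - by rewrite size_tuple sF; move: hh; rewrite (_ : (s.+1 - j + j).-1 = s) //; lia.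
    apply: subset_leq_card; apply/fintype.subsetP => x; rewrite !inE.
    case/and3P=> xU xt /exists_rem_all -[|z zF hz]; first by rewrite sF; lia.
    apply/hasP; exists z => //; rewrite /Q /clique /= all_cat pairwise_cat.
    have remF : subseq (rem z F) F by exact: rem_subseq.
    rewrite xU tU /= tt (pairwise_rem z Fadj) all_cat xt hz !andbT /=.
    apply/andP; split; first by apply/allP => y /(mem_subseq remF) /(allP FU).
    apply/allrelP => a b ta /(mem_subseq remF); exact: (allrelP tF).
  under [X in (_ <= X)%N]eq_bigr => z _
    do rewrite (card_tuple_cons _ (fun t => clique adj U (t ++ rem z F))).
  rewrite [X in (_ <= X)%N]exchange_big /=; apply: leq_sum => x _.
  apply: leq_trans (card_set_has _ _); apply: subset_leq_card.
  by apply/fintype.subsetP => t; rewrite !inE => /andP[].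
have [z zF hz] : exists2 z, z \in F &
  (h * #|[set t : j.-tuple V | clique adj U (t ++ F)]| <=
   s.+1 * #|[set t : j.+1.-tuple V | clique adj U (t ++ rem z F)]|)%N.
  have [|z zF hz] := pigeonhole_sum _ main; first by rewrite sF; lia.
  exists z => //; apply: leq_trans hz _; rewrite leq_mul2r sF.
  by rewrite (_ : _ - j <= _)%N ?orbT //; lia.
exists (rem z F); split.
- by rewrite size_rem // sF; lia.
- by rewrite /clique (pairwise_rem z Fadj) andbT; apply/allP => y /mem_rem /(allP FU).
rewrite !expnS.
have := leq_mul (leqnn h) hF; move=> /leq_trans; apply.
by rewrite mulnCA (mulnC s.+1) -mulnA leq_mul2l hz orbT.
Qed.

Lemma pairwise_tnth_sym (V : eqType) (adj : rel V) (N : nat) (g : N.-tuple V)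
    (i j : 'I_N) :
  symmetric adj -> pairwise adj g -> i != j -> adj (tnth g i) (tnth g j).
Proof.
move=> sym; have x0 := tnth g i; rewrite !(tnth_nth x0) => /(pairwiseP x0) hp.
rewrite -val_eqE /= neq_ltn => /orP[] ij; last rewrite sym.
  by apply: hp; rewrite ?inE ?size_tuple.
by apply: hp; rewrite ?inE ?size_tuple.
Qed.

(* Twice the number of edges spanned by [U]. *)
Definition degree_sum (V : finType) (adj : rel V) (U : {set V}) : nat :=
  (\sum_(v in U) #|[set w in U | adj v w]|)%N.

Lemma degree_sum_setD1 (V : finType) (adj : rel V) (U : {set V}) (v : V) :
  symmetric adj -> irreflexive adj -> v \in U ->
  degree_sum adj U = (degree_sum adj (U :\ v) + 2 * #|[set w in U | adj v w]|)%N.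
Proof.
move=> sym irr vU; rewrite /degree_sum (big_setD1 v vU) /=.
have -> : (\sum_(x in U :\ v) #|[set w in U | adj x w]| =
  \sum_(x in U :\ v) (#|[set w in U :\ v | adj x w]| + adj x v))%N.
  apply: eq_bigr => x _.
  rewrite (cardsD1 v [set w in U | adj x w]) addnC; congr (_ + _)%N.
    by apply: eq_card => w; rewrite !inE andbA.
  by rewrite !inE vU.
rewrite big_split /=.
have -> : (\sum_(x in U :\ v) adj x v = #|[set w in U | adj v w]|)%N.
  rewrite -big_mkcondr /= -sum1_card; apply: eq_bigl => w; rewrite !inE sym.
  by case: (eqVneq w v) => [->|_] //=; rewrite irr andbF.
by rewrite mul2n -addnn addnCA addnA addnC addnA.
Qed.

Lemma degree_sum_le (V : finType) (adj : rel V) (U : {set V}) :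
  (degree_sum adj U <= #|U| ^ 2)%N.
Proof.
rewrite /degree_sum -mulnn -sum_nat_const; apply: leq_sum => v _.
by apply: subset_leq_card; apply/fintype.subsetP => w; rewrite !inE => /andP[].
Qed.

(** * Turan numbers *)

Lemma TturanE (n s : nat) :
  Tturan n s = (\sum_(j < n) #|[set i : 'I_n | (i < j)%N && (i %% s != j %% s)%N]|)%N.
Proof.
rewrite /Tturan -sum1_card.
have -> : (\sum_(i in [set ij : 'I_n * 'I_n | (ij.1 < ij.2)%N &&
    (ij.1 %% s != ij.2 %% s)%N]%classic) 1 =
  \sum_(ij : 'I_n * 'I_n | (ij.1 < ij.2)%N && (ij.1 %% s != ij.2 %% s)%N) 1)%N.
  apply: eq_bigl => ij; apply/idP/idP; first by move/set_mem.
  by move=> h; apply/mem_set.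
rewrite (eq_bigl (fun ij : 'I_n * 'I_n => predT ij.1 &&
   ((ij.1 < ij.2)%N && (ij.1 %% s != ij.2 %% s)%N))) //.
rewrite -(pair_big_dep predT (fun i j : 'I_n => (i < j)%N && (i %% s != j %% s)%N)
  (fun _ _ => 1%N)) /= (exchange_big_dep predT) //=.
by apply: eq_bigr => j _; rewrite sum1dep_card.
Qed.

(** The quotient is the ceiling of [(m - r) / s], which steps up exactly when [m] is congruent to
    [r]. *)
Lemma card_residue_below (m s r : nat) : (r < s)%N ->
  (\sum_(i < m) (i %% s == r) = (m + s.-1 - r) %/ s)%N.
Proof.
move=> rs; have s0 : (0 < s)%N by apply: leq_ltn_trans rs.
elim: m => [|m IH]; first by rewrite big_ord0 divn_small //; lia.
rewrite big_ord_recr /= IH.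
rewrite (_ : m.+1 + s.-1 - r = (m + s.-1 - r).+1)%N; last lia.
rewrite divnS // addnC; congr (nat_of_bool _ + _)%N.
rewrite (_ : (m + s.-1 - r).+1 = m + (s - r))%N; last lia.
rewrite {2}(divn_eq m s) -addnA dvdn_addr ?dvdn_mull //.
have := ltn_pmod m s0; move: (m %% s)%N => t ts.
case: (ltngtP t r) => [tr|rt|->].
- by rewrite gtnNdvd //; lia.
- rewrite (_ : t + (s - r) = (t - r) + s)%N; last lia.
  by rewrite dvdn_addl // gtnNdvd //; lia.
- by rewrite subnKC ?dvdnn // ltnW.
Qed.

Lemma card_congruent_below (m s : nat) :
  (0 < s)%N -> (\sum_(i < m) (i %% s != m %% s) = m - m %/ s)%N.
Proof.
move=> s0.
have e : (\sum_(i < m) (i %% s == m %% s) = m %/ s)%N.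
  rewrite card_residue_below ?ltn_pmod // {1}(divn_eq m s).
  have := ltn_pmod m s0; move: (m %% s)%N => r rs.
  rewrite (_ : m %/ s * s + r + s.-1 - r = m %/ s * s + s.-1)%N; last lia.
  by rewrite divnMDl // [(s.-1 %/ s)%N]divn_small ?addn0 ?prednK.
have : (\sum_(i < m) ((i %% s == m %% s) + (i %% s != m %% s)) = m)%N.
  rewrite (eq_bigr (fun => 1%N)); first by rewrite sum1_card card_ord.
  by move=> i _; case: eqP.
by rewrite big_split /= e; lia.
Qed.

(** The new vertex [n] is joined to all earlier ones except the [n %/ s] in its residue class. *)
Lemma TturanS (n s : nat) : (0 < s)%N ->
  Tturan n.+1 s = (Tturan n s + (n - n %/ s))%N.
Proof.
move=> s0; rewrite !TturanE big_ord_recr /=; congr (_ + _)%N.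
  apply: eq_bigr => j _.
  rewrite -!sum1dep_card !big_mkcond /= big_ord_recr /= [(n < j)%N]ltnNge (ltnW (ltn_ord j)) addn0.
  by rewrite [RHS]big_mkcond.
rewrite -card_congruent_below // -sum1dep_card big_mkcond big_ord_recr /= ltnn addn0.
by apply: eq_bigr => i _; rewrite ltn_ord /=; case: (_ == _).
Qed.

(** The term [r (s - r)], with [r] the residue of [n], measures up to the factor [2 s] how far the
    balanced graph falls short of [(1 - 1/s) n^2 / 2]. *)
Lemma Tturan_exact (n s : nat) : (0 < s)%N ->
  (2 * s * Tturan n s + (n %% s) * (s - n %% s) = s.-1 * n ^ 2)%N.
Proof.
move=> s0; elim: n => [|n IH].
  by rewrite mod0n TturanE big_ord0 !muln0 mul0n.
have rs := ltn_pmod n s0; have nE := divn_eq n s.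
move: (n %/ s)%N (n %% s)%N rs nE IH (TturanS n s0) => q r rs nE IH ->.
(* The residue grows by one, or it is [s.-1] and returns to 0 while the quotient grows. *)
have [r1|r1] := ltnP r.+1 s.
  rewrite {}nE -addnS modnMDl modn_small // in IH *.
  have [e se] : exists e, s = (r + e).+2 by exists (s - r.+2)%N; lia.
  have -> : (q * s + r - q = q * (r + e).+1 + r)%N by rewrite se; lia.
  have -> : (s - r.+1 = e.+1)%N by lia.
  have {}IH : (2 * s * Tturan (q * s + r) s + r * e.+2 = s.-1 * (q * s + r) ^ 2)%N.
    by rewrite -IH; congr (_ + _ * _)%N; lia.
  move: IH; move: (Tturan _ _) => T; rewrite se /= -!mulnn; lia.
have {r1 rs}rE : s = r.+1 by lia.
rewrite {}nE -addnS modnMDl -rE modnn in IH *.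
have -> : (q * s + r - q = q * r + r)%N by rewrite rE; lia.
have {}IH : (2 * s * Tturan (q * s + r) s + r = s.-1 * (q * s + r) ^ 2)%N.
  by rewrite -IH rE subSnn muln1.
by move: IH; move: (Tturan _ _) => T; rewrite rE /= -!mulnn; lia.
Qed.

(** If every vertex misses at most [(|U| - 1) / s] vertices, itself included, the greedy count with
    [h = 1] finds the clique. Otherwise some vertex has degree at most the increment of [TturanS],
    and deleting it preserves the excess. *)
Lemma turan (V : finType) (adj : rel V) (s : nat) (U : {set V}) :
  symmetric adj -> irreflexive adj -> (0 < s)%N ->
  (2 * Tturan #|U| s < degree_sum adj U)%N ->
  exists F : seq V, size F = s.+1 /\ clique adj U F.
Proof.
move=> sym irr s0; have [m] := ubnP #|U|; elim: m => // m IH in U *.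
rewrite ltnS => Um hU.
have [|/forall_inPn [v vU]] :=
  boolP [forall v in U, #|[set w in U | ~~ adj v w]| <= #|U|.-1 %/ s]%N.
  move=> /forall_inP hD.
  have U0 : (0 < #|U|)%N.
    rewrite lt0n; apply/negP => /eqP U0; move: hU; rewrite U0.
    by rewrite /degree_sum (cards0_eq U0) big_set0.
  have := @clique_count V adj U (#|U|.-1 %/ s) 1 s.+1 sym hD.
  rewrite exp1n /= card_gt0 => /(_ _)/set0Pn[].
    by have := leq_trunc_div #|U|.-1 s; rewrite mulnC; lia.
  move=> t; rewrite inE => ct; exists t; split=> //; exact: size_tuple.
rewrite -ltnNge => hv.
have cU := cardsD1 v U; rewrite vU add1n in cU.
have [] := IH (U :\ v).
- by rewrite -ltnS -cU.
- move: hU; rewrite (degree_sum_setD1 sym irr vU) cU TturanS // mulnDr.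
  have hc : (#|[set w in U | adj v w]| + #|[set w in U | ~~ adj v w]| = #|U|)%N.
    rewrite -(cardsID [set w | adj v w] U); congr (_ + _)%N.
      by apply: eq_card => w; rewrite !inE.
    by apply: eq_card => w; rewrite !inE andbC.
  rewrite cU /= in hv hc *; lia.
- move=> F [sF cF]; exists F; split=> //.
  case/andP: cF => FU Fp; rewrite /clique Fp andbT.
  by apply/allP => x /(allP FU); rewrite !inE => /andP[].
Qed.

(* The set [U] maximizes the weight
   [4 s^2 * degree_sum U - (4 s^2 - 4 s - 1) |U|^2]; removing a vertex cannot
   increase it, which bounds the degrees in [U] from below. *)
Lemma dense_subgraph (V : finType) (adj : rel V) (s : nat) :
  symmetric adj -> irreflexive adj -> (0 < s)%N ->
  (4 * s ^ 3 < #|V|)%N ->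
  (8 * s ^ 2 * (2 * Tturan #|V| s) <= 8 * s ^ 2 * degree_sum adj [set: V] + #|V| ^ 2)%N ->
  exists U : {set V}, [/\ (#|V| <= 5 * s * #|U|)%N,
    (forall v, v \in U -> 8 * s ^ 2 * #|[set w in U | ~~ adj v w]| <=
       (8 * s + 2) * #|U| + 4 * s ^ 2)%N &
    (2 * Tturan #|V| s < degree_sum adj [set: V] ->
     2 * Tturan #|U| s < degree_sum adj U)%N].
Proof.
move=> sym irr s0 nV hV.
(* With this [c], a degree sum of [2 T(n, s)] on [n] vertices has weight between [n^2 - 4 s^3] and
   [n^2]. *)
pose c : int := 4 * s%:Z ^+ 2 - 4 * s%:Z - 1.
pose Phi (U : {set V}) : int :=
  4 * s%:Z ^+ 2 * (degree_sum adj U)%:Z - c * (#|U|)%:Z ^+ 2.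
have [U _ maxU] : exists2 U : {set V}, true & forall U', Phi U' <= Phi U.
  case: (Order.TotalTheory.arg_maxP (i0 := [set: V]) Phi (P := predT)) => // U _ h.
  by exists U => // U'; apply: h.
have Tn := Tturan_exact #|V| s0.
have cS : #|[set: V]| = #|V| by rewrite cardsT.
have rn : (#|V| %% s * (s - #|V| %% s) <= s ^ 2)%N.
  by rewrite -mulnn leq_mul ?leq_subr // ltnW // ltn_pmod.
have sE : exists s', s = s'.+1 by exists s.-1; rewrite prednK.
(* By [Tturan_exact], [8 s^2] times the degree sum is at least [(8 s^2 - 8 s - 1) n^2 - 8 s^3],
   whereas [2 c] is [8 s^2 - 8 s - 2]. *)
have PhiV : (#|V|)%:Z ^+ 2 - 8 * s%:Z ^+ 3 <= 2 * Phi [set: V].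
  rewrite /Phi cS /c.
  have := congr1 (muln (8 * s)) Tn; have := leq_mul (leqnn (8 * s)) rn.
  move: hV; move: #|V| (degree_sum _ _) (Tturan _ _) (_ %% s * _)%N => n E T r.
  by case: sE => s' -> /=; rewrite -?mulnn ?expnS ?expn0; lia.
exists U; split.
- have hU := degree_sum_le adj U; have hPU := maxU [set: V].
  have hP : (#|V| ^ 2 <= 2 * (4 * s + 1) * #|U| ^ 2 + 8 * s ^ 3)%N.
    move: (le_trans PhiV (ler_wpM2l (ler0n _ 2) hPU)).
    have := leq_mul (leqnn (8 * s ^ 2)) hU.
    rewrite /Phi /c; move: (degree_sum _ _) #|U| #|V| => E m n.
    by case: sE => s' ->; rewrite -?mulnn ?expnS ?expn0; lia.
  rewrite -leq_sqr.
  move: hP nV; move: #|U| #|V| => m n hP nV.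
  have nn : (8 * s ^ 3 + 8 * s ^ 3 <= n ^ 2)%N.
    have : (4 * s ^ 3 * (4 * s ^ 3) <= n ^ 2)%N.
      by rewrite -mulnn leq_mul // ltnW.
    apply: leq_trans; rewrite mulnACA addnn -muln2 mulnAC leq_mul2l /=.
    by rewrite leq_pmulr // expn_gt0 s0.
  have m1 : (m ^ 2 <= s * m ^ 2)%N by rewrite leq_pmull.
  have m2 : (s * m ^ 2 <= s ^ 2 * m ^ 2)%N by rewrite leq_mul2r -{1}(expn1 s) leq_pexp2l ?orbT.
  rewrite !expnMn; lia.
- move=> v vU; have := maxU (U :\ v); rewrite /Phi (degree_sum_setD1 sym irr vU).
  have hc : (#|[set w in U | adj v w]| + #|[set w in U | ~~ adj v w]| = #|U|)%N.
    rewrite -(cardsID [set w | adj v w] U); congr (_ + _)%N.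
      by apply: eq_card => w; rewrite !inE.
    by apply: eq_card => w; rewrite !inE andbC.
  have := cardsD1 v U; rewrite vU add1n; move: hc; rewrite /c.
  move: #|[set w in U | adj v w]| #|[set w in U | ~~ adj v w]|
    (degree_sum _ _) #|U :\ v| #|U| => a b E m1 m hab hm.
  by case: sE => s' ->; rewrite -?mulnn ?expnS ?expn0; lia.
(* If [U], of size [m < n = |V|], lost the excess, its weight would be at most [m^2] and that of the
   whole graph at least [n^2 - 4 s^3]; but [n^2 - m^2 >= 2 n - 1]. *)
- move=> hT; rewrite ltnNge; apply/negP => hE.
  have [UV|UnV] := eqVneq #|U| #|V|.
    have UT : U = [set: V] by apply/eqP; rewrite eqEcard finset.subsetT /= cS -UV.
    by move: hT; rewrite ltnNge -UT -UV hE.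
  have Um : (#|U| < #|V|)%N by rewrite ltn_neqAle UnV max_card.
  have TU := Tturan_exact #|U| s0.
  have nm : (#|U| * #|U| + 2 * #|V| <= #|V| * #|V| + 1)%N.
    by rewrite -(subnKC Um); move: #|U| (#|V| - _)%N; clear => m k; nia.
  have F1 := congr1 (muln (4 * s)) Tn; have F2 := congr1 (muln (4 * s)) TU.
  have F3 := leq_mul (leqnn (4 * s)) rn.
  have F4 := leq_mul (leqnn (4 * s ^ 2)) hT.
  have F5 := leq_mul (leqnn (4 * s ^ 2)) hE.
  move: (maxU [set: V]) nm nV F1 F2 F3 F4 F5; rewrite /Phi cS /c.
  case: sE => s' ->; clear.
  move: #|V| #|U| (degree_sum _ _) (degree_sum _ _) => n m E1 E2.
  move: (_ %% _ * _)%N (_ %% _ * _)%N (Tturan _ _) (Tturan _ _) => r1 r2 T1 T2.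
  by rewrite /= -?mulnn ?expnS ?expn0; lia.
Qed.

(** A vertex of [U] misses about [(1/s + 1/(4 s^2)) |U|] others; [2 s - 1] times this leaves at
    least [|U| / (2 s)] of [2 |U|]. Taking [h] near [|U| / (8 s)] uses half of that, and the rest
    absorbs the rounding. *)
Lemma dense_subgraph_codegree (V : finType) (adj : rel V) (s : nat) :
  symmetric adj -> irreflexive adj -> (0 < s)%N ->
  (40 * s ^ 3 < #|V|)%N ->
  (8 * s ^ 2 * (2 * Tturan #|V| s) <= 8 * s ^ 2 * degree_sum adj [set: V] + #|V| ^ 2)%N ->
  exists (U : {set V}) (D h : nat), [/\ (#|V| <= 80 * s ^ 2 * h)%N,
    (forall v, v \in U -> #|[set w in U | ~~ adj v w]| <= D)%N,
    (2 * h + (2 * s - 1) * D <= 2 * #|U|)%N &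
    (2 * Tturan #|V| s < degree_sum adj [set: V] ->
     2 * Tturan #|U| s < degree_sum adj U)%N].
Proof.
move=> sym irr s0 nV hV.
have [|U [VU hU hT]] := dense_subgraph sym irr s0 _ hV.
  by apply: leq_ltn_trans nV; rewrite leq_mul2r orbT.
have s20 : (0 < 8 * s ^ 2)%N by rewrite muln_gt0 expn_gt0 s0.
exists U, (((8 * s + 2) * #|U| + 4 * s ^ 2) %/ (8 * s ^ 2))%N, (#|U| %/ (8 * s))%N.
have mU : (8 * s ^ 2 <= #|U|)%N.
  have : (5 * s * (8 * s ^ 2) <= 5 * s * #|U|)%N.
    by apply: leq_trans VU; apply: ltnW; move: nV; rewrite !expnS expn0; lia.
  by rewrite leq_pmul2l // muln_gt0.
have s80 : (0 < 8 * s)%N by rewrite muln_gt0.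
have ss : (8 * s <= 8 * s ^ 2)%N by rewrite leq_mul2l -{1}(expn1 s) leq_pexp2l ?orbT.
split => //.
- apply: leq_trans VU _.
  have : (0 < #|U| %/ (8 * s))%N by rewrite divn_gt0 //; apply: leq_trans mU.
  have := ltn_ceil #|U| s80; move: #|U| (#|U| %/ _)%N => m h h1 h0.
  have {}h1 : (m <= 8 * s * h * 2)%N by apply: leq_trans (ltnW h1) _; nia.
  apply: leq_trans (leq_mul (leqnn (5 * s)%N) h1) _.
  by rewrite -mulnn; lia.
- by move=> v /hU hv; rewrite leq_divRL // mulnC.
- rewrite -(leq_pmul2l s20).
  have := leq_trunc_div #|U| (8 * s).
  have := leq_trunc_div ((8 * s + 2) * #|U| + 4 * s ^ 2) (8 * s ^ 2).
  move: mU; move: #|U| (_ %/ (8 * s ^ 2))%N (#|U| %/ _)%N => m D h mU hD hh.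
  have {}hD := leq_mul (leqnn (2 * s - 1)) hD.
  have {}hh := leq_mul (leqnn (2 * s)) hh.
  have sm : (4 * s * s ^ 2 <= s * m)%N.
    by rewrite mulnAC mulnC leq_mul2l (leq_trans _ mU) ?orbT // leq_mul2r orbT.
  have [s' sE] : exists s', s = s'.+1 by exists s.-1; rewrite prednK.
  have e : (2 * s - 1 = (2 * s').+1)%N by rewrite sE; lia.
  move: hD hh sm; rewrite e sE -?mulnn; clear; lia.
Qed.

(** As the cliques have only [s] vertices, the degree sum may fall short of [2 T(n, s)] by
    [n^2 / (8 s^2)]; this pays for discarding short edges. *)
Lemma many_cliques (V : finType) (adj : rel V) (s : nat) :
  symmetric adj -> irreflexive adj -> (0 < s)%N ->
  (40 * s ^ 3 < #|V|)%N ->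
  (8 * s ^ 2 * (2 * Tturan #|V| s) <= 8 * s ^ 2 * degree_sum adj [set: V] + #|V| ^ 2)%N ->
  (#|V| ^ s <= (80 * s ^ 2) ^ s * #|[set t : s.-tuple V | pairwise adj t]|)%N.
Proof.
move=> sym irr s0 nV hV.
have [U [D [h [Vh hD hh _]]]] := dense_subgraph_codegree sym irr s0 nV hV.
apply: leq_trans (_ : (80 * s ^ 2 * h) ^ s <= _)%N; first by rewrite leq_exp2r.
rewrite expnMn leq_mul2l; apply/orP; right.
apply: leq_trans (clique_count (N := s) sym hD _) _.
  case: s hh {s0 nV hV Vh} => //= [|s]; lia.
by apply: subset_leq_card; apply/fintype.subsetP => t; rewrite !inE => /andP[].
Qed.

(** The clique on [s.+1] vertices from [turan] is reduced by [s.-1] exchanges in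
    [cliques_on_subclique]; the two vertices left are [p] and [q]. *)
Lemma heavy_edge (V : finType) (adj : rel V) (s : nat) :
  symmetric adj -> irreflexive adj -> (0 < s)%N ->
  (40 * s ^ 3 < #|V|)%N ->
  (2 * Tturan #|V| s < degree_sum adj [set: V])%N ->
  exists p q : V, (#|V| ^ s.-1 <= (80 * s ^ 2 * s.+1) ^ s.-1 *
     #|[set t : s.-1.-tuple V | pairwise adj (p :: q :: t)]|)%N.
Proof.
move=> sym irr s0 nV hV.
have [|U [D [h [Vh hD hh hT]]]] := dense_subgraph_codegree sym irr s0 nV _.
  by apply: leq_trans (leq_addr _ _); rewrite leq_mul2l ltnW ?orbT.
have [|F [sF cF hF]] := cliques_on_subclique (j := s.-1) sym hD hh _ (turan sym irr s0 (hT hV)).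
  by rewrite prednK.
case: F sF cF hF => [|p [|q [|? ?]]] /=; try lia.
move=> _ _ hF; exists p, q.
apply: leq_trans (_ : (80 * s ^ 2 * h) ^ s.-1 <= _)%N.
  by case: (s.-1) => // m; rewrite leq_exp2r.
rewrite (expnMn _ h) (expnMn _ s.+1) -mulnA leq_mul2l; apply/orP; right.
apply: leq_trans hF _; rewrite leq_mul2l; apply/orP; right.
apply: subset_leq_card; apply/fintype.subsetP => t.
by rewrite !inE clique_catC //= => /andP[].
Qed.

(** * Tuples with a replacement in every direction *)

Definition replace (V : Type) (N : nat) (g : N.-tuple V) (i : 'I_N) (y : V) :
  N.-tuple V := [tuple if j == i then y else tnth g j | j < N].

Lemma tnth_replace (V : Type) (N : nat) (g : N.-tuple V) (i j : 'I_N) (y : V) :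
  tnth (replace g i y) j = if j == i then y else tnth g j.
Proof. exact: tnth_mktuple. Qed.

Lemma replace_replace (V : Type) (N : nat) (g : N.-tuple V) (i : 'I_N) (y z : V) :
  replace (replace g i y) i z = replace g i z.
Proof.
by apply: eq_from_tnth => j; rewrite !tnth_replace; case: eqP.
Qed.

Lemma replace_id (V : Type) (N : nat) (g : N.-tuple V) (i : 'I_N) :
  replace g i (tnth g i) = g.
Proof. by apply: eq_from_tnth => j; rewrite tnth_replace; case: eqP => [->|]. Qed.

(* [(g, y) |-> (replace g i y, tnth g i)] is an involution. *)
Lemma card_by_fibres (V : finType) (N : nat) (i : 'I_N) (X Y : {set N.-tuple V})
    (B : nat) :
  Y \subset X ->
  (forall g y, g \in X -> replace g i y \in X) ->
  (forall g, g \in X -> (#|[set y | replace g i y \in Y]| <= B)%N) ->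
  (#|V| * #|Y| <= #|X| * B)%N.
Proof.
move=> YX Xr hB.
pose phi (gy : N.-tuple V * V) := (replace gy.1 i gy.2, tnth gy.1 i).
have phiK : involutive phi.
  by case=> g y; rewrite /phi /= replace_replace replace_id tnth_replace eqxx.
have -> : (#|V| * #|Y|)%N = (\sum_(gy : N.-tuple V * V | gy.1 \in Y) 1)%N.
  rewrite mulnC -(cardsT V) -cardsX -sum1_card; apply: eq_bigl => -[g y].
  by rewrite !inE andbT.
rewrite (reindex_inj (inv_inj phiK)) /=.
apply: leq_trans (_ : \sum_(g in X) #|[set y | replace g i y \in Y]| <= _)%N.
  under [X in (_ <= X)%N]eq_bigr do rewrite -sum1dep_card.
  rewrite pair_big_dep /= [X in (_ <= X)%N]big_mkcond /= [X in (X <= _)%N]big_mkcond /=.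
  apply: leq_sum => -[g y] _ /=; case: ifP => // gY.
  by rewrite -(replace_id g i) -(replace_replace g i y) Xr // (fintype.subsetP YX).
by rewrite -sum_nat_const; apply: leq_sum => g /hB.
Qed.

Lemma leq_card_bigcup (T J : finType) (I : {set J}) (F : J -> {set T}) :
  (#|\bigcup_(i in I) F i| <= \sum_(i in I) #|F i|)%N.
Proof.
apply: (big_ind2 (fun (A : {set T}) n => #|A| <= n)%N) => //; first by rewrite cards0.
by move=> A a B b hA hB; apply: leq_trans (leq_card_setU _ _) (leq_add hA hB).
Qed.

(** Fix a direction [i] and all entries but the [i]-th: bad entries of one class are pairwise not
    far, so there are at most [#|C| * P] of them. Summed over fibres and directions, the bad tuples
    cannot exhaust [W]. *)
Lemma exists_good_tuple (V C : finType) (N P : nat) (X W : {set N.-tuple V})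
    (I : {set 'I_N}) (cls : 'I_N -> N.-tuple V -> V -> C) (far : rel V) :
  W \subset X ->
  (forall i g y, i \in I -> g \in X -> replace g i y \in X) ->
  (forall i g y z, cls i (replace g i z) y = cls i g y) ->
  (forall S : {set V}, (forall y z, y \in S -> z \in S -> ~~ far y z) ->
     (#|S| <= P)%N) ->
  (N * (#|X| * (#|C| * P)) < #|V| * #|W|)%N ->
  exists2 g, g \in W & forall i, i \in I ->
    exists y, [/\ replace g i y \in W, cls i g y = cls i g (tnth g i) &
                  far (tnth g i) y].
Proof.
move=> WX Xr clsr hP hW.
pose good i g := [exists y, [&& replace g i y \in W,
  cls i g y == cls i g (tnth g i) & far (tnth g i) y]].
pose bad i := [set g in W | ~~ good i g].
have hbad i : i \in I -> (#|V| * #|bad i| <= #|X| * (#|C| * P))%N.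
  move=> iI; apply: (card_by_fibres (i := i)).
  - by apply: fintype.subset_trans WX; apply/fintype.subsetP => g; rewrite inE => /andP[].
  - by move=> g y gX; exact: Xr.
  move=> g gX.
  rewrite -sum1_card (partition_big (cls i g) predT) //= mulnC.
  rewrite -[X in (_ <= X)%N]mulnC -sum_nat_const; apply: leq_sum => c _.
  rewrite sum1dep_card; apply: hP => y z.
  rewrite !inE => /andP[/andP[yW ybad] /eqP yc] /andP[/andP[zW zbad] /eqP zc].
  apply/negP => fyz; move/negP: ybad; apply; apply/existsP; exists z.
  by rewrite replace_replace zW tnth_replace eqxx fyz !clsr yc zc eqxx.
have : (#|\bigcup_(i in I) bad i| < #|W|)%N.
  rewrite ltnNge; apply/negP => hWb; move: hW; rewrite ltnNge => /negP; apply.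
  apply: leq_trans (leq_mul (leqnn #|V|) hWb) _.
  apply: leq_trans (leq_mul (leqnn #|V|) (leq_card_bigcup _ _)) _.
  rewrite big_distrr /=; apply: (@leq_trans (\sum_(i in I) #|X| * (#|C| * P))%N).
    by apply: leq_sum => i; apply: hbad.
  have IN : (#|I| <= N)%N by rewrite -[X in (_ <= X)%N]card_ord max_card.
  by rewrite sum_nat_const leq_mul2r IN orbT.
rewrite ltnNge => /negP nsub.
have /subsetPn [g gW hg] : ~~ (W \subset \bigcup_(i in I) bad i).
  by apply/negP => /subset_leq_card.
exists g => // i iI; have : good i g.
  apply: contraT => ng; move/negP: hg; case; apply/finset.bigcupP; exists i => //.
  by rewrite /bad inE gW ng.
by rewrite /good => /existsP[y /and3P[? /eqP ? ?]]; exists y.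
Qed.

(** * Euclidean geometry *)

Lemma dotpC (d : nat) (v w : 'rV[RR]_d) : dotp v w = dotp w v.
Proof. by apply: eq_bigr => i _; rewrite mulrC. Qed.

Lemma dotpDl (d : nat) (u v w : 'rV[RR]_d) : dotp (u + v) w = dotp u w + dotp v w.
Proof. by rewrite -big_split; apply: eq_bigr => i _; rewrite mxE mulrDl. Qed.

Lemma dotpZl (d : nat) (a : RR) (v w : 'rV[RR]_d) : dotp (a *: v) w = a * dotp v w.
Proof. by rewrite /dotp mulr_sumr; apply: eq_bigr => i _; rewrite mxE mulrA. Qed.

Lemma dotpNl (d : nat) (v w : 'rV[RR]_d) : dotp (- v) w = - dotp v w.
Proof. by rewrite -scaleN1r dotpZl mulN1r. Qed.

Lemma dotpDr (d : nat) (u v w : 'rV[RR]_d) : dotp u (v + w) = dotp u v + dotp u w.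
Proof. by rewrite dotpC dotpDl !(dotpC u). Qed.

Lemma dotpZr (d : nat) (a : RR) (v w : 'rV[RR]_d) : dotp v (a *: w) = a * dotp v w.
Proof. by rewrite dotpC dotpZl dotpC. Qed.

Lemma dotpNr (d : nat) (v w : 'rV[RR]_d) : dotp v (- w) = - dotp v w.
Proof. by rewrite dotpC dotpNl dotpC. Qed.

Lemma dotp_ge0 (d : nat) (v : 'rV[RR]_d) : 0 <= dotp v v.
Proof. by apply: sumr_ge0 => i _; rewrite -expr2 sqr_ge0. Qed.

Lemma enorm_ge0 (d : nat) (v : 'rV[RR]_d) : 0 <= enorm v.
Proof. exact: sqrtr_ge0. Qed.

Lemma enorm_sqr (d : nat) (v : 'rV[RR]_d) : enorm v ^+ 2 = dotp v v.
Proof. by rewrite sqr_sqrtr // dotp_ge0. Qed.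

Lemma enormZ (d : nat) (a : RR) (v : 'rV[RR]_d) : enorm (a *: v) = `|a| * enorm v.
Proof. by rewrite /enorm dotpZl dotpZr mulrA -expr2 sqrtrM ?sqr_ge0 // sqrtr_sqr. Qed.

Lemma enormN (d : nat) (v : 'rV[RR]_d) : enorm (- v) = enorm v.
Proof. by rewrite -scaleN1r enormZ normrN1 mul1r. Qed.

Lemma enorm_gt0 (d : nat) (v : 'rV[RR]_d) : (0 < enorm v) = (v != 0).
Proof.
rewrite sqrtr_gt0 lt0r dotp_ge0 andbT; congr (~~ _).
apply/eqP/eqP => [/eqP|->]; last by rewrite /dotp big1 // => i _; rewrite mxE mul0r.
rewrite psumr_eq0 => [/allP h|i _]; last by rewrite -expr2 sqr_ge0.
apply/rowP => i; rewrite mxE; apply/eqP; rewrite -sqrf_eq0 expr2.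
by have := h i (mem_index_enum _).
Qed.

Lemma cauchy_schwarz (d : nat) (v w : 'rV[RR]_d) : `|dotp v w| <= enorm v * enorm w.
Proof.
have [->|w0] := eqVneq w 0.
  by rewrite -(scale0r 0) dotpZr mul0r normr0 mulr_ge0 ?enorm_ge0.
rewrite -ler_sqr ?nnegrE ?mulr_ge0 ?enorm_ge0 // exprMn !enorm_sqr real_normK ?num_real //.
have w2 : 0 < dotp w w by rewrite -enorm_sqr exprn_gt0 // enorm_gt0.
have := dotp_ge0 (dotp w w *: v + (- dotp v w) *: w).
rewrite !(dotpDl, dotpDr, dotpZl, dotpZr, dotpNl, dotpNr) (dotpC w v) => h.
rewrite -(ler_pM2l w2); nra.
Qed.

Lemma enormD_le (d : nat) (v w : 'rV[RR]_d) : enorm (v + w) <= enorm v + enorm w.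
Proof.
rewrite -ler_sqr ?nnegrE ?addr_ge0 ?enorm_ge0 //.
rewrite enorm_sqr dotpDl !dotpDr (dotpC w v) sqrrD !enorm_sqr.
have := cauchy_schwarz v w; have := ler_norm (dotp v w); lra.
Qed.

Lemma edistC (d : nat) (p q : 'rV[RR]_d) : edist p q = edist q p.
Proof. by rewrite /edist -enormN opprB. Qed.

Lemma edist_triangle (d : nat) (p q r : 'rV[RR]_d) :
  edist p r <= edist p q + edist q r.
Proof. by rewrite /edist -(subrKA q p) enormD_le. Qed.

Lemma coord_le_enorm (d : nat) (v : 'rV[RR]_d) (i : 'I_d) : `|v 0 i| <= enorm v.
Proof.
rewrite -ler_sqr ?nnegrE ?enorm_ge0 // enorm_sqr real_normK ?num_real //.
rewrite /dotp (bigD1 i) //= -expr2 lerDl.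
by apply: sumr_ge0 => j _; rewrite -expr2 sqr_ge0.
Qed.

Lemma enorm_lt_coord (d : nat) (v : 'rV[RR]_d) (h : RR) :
  (0 < d)%N -> (forall i, `|v 0 i| < h) -> enorm v < d%:R * h.
Proof.
move=> d0 hv; have h0 : 0 < h by apply: le_lt_trans (hv (Ordinal d0)).
have dd : 1 <= d%:R :> RR by rewrite ler1n.
rewrite -ltr_sqr ?nnegrE ?enorm_ge0 ?mulr_ge0 ?ltW //; last by apply: lt_le_trans dd.
rewrite enorm_sqr exprMn.
apply: (@lt_le_trans _ _ (d%:R * h ^+ 2)).
  rewrite mulr_natl -[d in _ *+ d]card_ord -sumr_const /dotp.
  apply: ltr_sum; first by apply/hasP; exists (Ordinal d0); rewrite ?mem_index_enum.
  move=> i _; rewrite -expr2 -real_normK ?num_real //.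
  by rewrite ltr_sqr ?nnegrE // ltW.
by rewrite ler_wpM2r ?sqr_ge0 // expr2 ler_pMr // ltr0n.
Qed.

(* Truncation is only well behaved on nonnegative numbers, hence the shift by
   [rho]. *)
Lemma grid (d Q : nat) (rho h : RR) (o : 'rV[RR]_d) :
  (0 < d)%N -> 0 < h -> 2 * rho < Q.+1%:R * h ->
  exists cell : 'rV[RR]_d -> {ffun 'I_d -> 'I_Q.+1}, forall v w,
    edist v o <= rho -> edist w o <= rho -> cell v = cell w ->
    edist v w < d%:R * h.
Proof.
move=> d0 h0 hQ.
pose z (v : 'rV[RR]_d) (i : 'I_d) := ((v - o) 0 i + rho) / h.
exists (fun v => [ffun i => inord (Num.truncn (z v i))]) => v w vo wo vw.
have zb u i : edist u o <= rho -> 0 <= z u i /\ (Num.truncn (z u i) < Q.+1)%N.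
  move=> uo; have := le_trans (coord_le_enorm (u - o) i) uo.
  rewrite ler_norml => /andP[h1 h2].
  have z0 : 0 <= z u i by rewrite /z divr_ge0 ?(ltW h0) //; lra.
  split=> //; rewrite truncn_lt_nat // /z ltr_pdivrMr //; lra.
apply: enorm_lt_coord => // i.
have [v0 vQ] := zb v i vo; have [w0 wQ] := zb w i wo.
have /(congr1 (fun g : {ffun 'I_d -> 'I_Q.+1} => val (g i))) := vw.
rewrite !ffunE /= !inordK // => e.
have := truncn_itv v0; have := truncn_itv w0; rewrite e.
move: (Num.truncn _) => k /andP[a1 a2] /andP[b1 b2].
have -> : (v - w) 0 i = h * (z v i - z w i).
  by rewrite /z !mxE; field; rewrite lt0r_neq0.
rewrite normrM gtr0_norm // -[X in _ < X]mulr1 ltr_pM2l //.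
rewrite ltr_norml; move: a2 b2; rewrite -natr1; lra.
Qed.

(** A grid cell of side [1 / d] has diameter below 1 and so holds at most one point; there are at
    most [2 rho d + 1 <= 3 d rho] cells in each coordinate. *)
Lemma packing (d n : nat) (f : 'I_n -> 'rV[RR]_d) (p : 'I_n) (rho : RR)
    (S : {set 'I_n}) :
  (0 < d)%N -> separated f -> 1 <= rho ->
  (forall y, y \in S -> edist (f y) (f p) <= rho) ->
  #|S|%:R <= (3 * d%:R * rho) ^+ d :> RR.
Proof.
move=> d0 sf rho1 hS.
have dd : 1 <= d%:R :> RR by rewrite ler1n.
have di : 0 < (d%:R)^-1 :> RR by rewrite invr_gt0; apply: lt_le_trans dd.
pose Q := Num.truncn (2 * rho * d%:R).
have hQ : 2 * rho < Q.+1%:R * (d%:R)^-1.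
  by rewrite ltr_pdivlMr ?truncnS_gt // ltr0n.
have [cell hc] := grid (f p) d0 di hQ.
have inj : {in S &, injective (cell \o f)}.
  move=> y z yS zS /= e; apply/eqP; apply/negPn/negP => yz.
  have := hc _ _ (hS y yS) (hS z zS) e.
  by rewrite divff ?lt0r_neq0 ?ltr0n // ltNge sf.
have : (#|S| <= Q.+1 ^ d)%N.
  by rewrite -(card_in_imset inj) (leq_trans (max_card _)) // card_ffun !card_ord.
rewrite -(ler_nat RR) => /le_trans; apply; rewrite natrX.
rewrite lerXn2r ?nnegrE ?ler0n ?mulr_ge0 //; try lra; try exact: ler0n.
rewrite -natr1; have : Q%:R <= 2 * rho * d%:R.
  by rewrite truncn_le !mulr_ge0 //; try lra.
nra.
Qed.

(** * Flatness *)

(** Continuity of [acos] at 1: for [alpha < pi] it suffices that [z >= cos alpha]. *)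
Lemma acos_small (alpha : RR) : 0 < alpha ->
  exists2 s : RR, 0 < s < 1 & forall z, 1 - s <= z -> z <= 1 -> acos z <= alpha.
Proof.
move=> a0; have [api|pia] := ltP alpha pi; last first.
  exists 2^-1; first lra.
  by move=> z z1 z2; apply: le_trans pia; apply: acos_lepi; lra.
have c1 : cos alpha < 1.
  by rewrite -cos0 ltr_cos // in_itv /=; lra.
exists (Num.min 2^-1 (1 - cos alpha)).
  rewrite lt_min gt_min subr_gt0 c1; lra.
move=> z z1 z2.
have z3 : 2^-1 <= z.
  by apply: le_trans z1; rewrite lerBrDr -lerBrDl ge_min; apply/orP; left; lra.
have z4 : cos alpha <= z.
  by apply: le_trans z1; rewrite lerBrDr -lerBrDl ge_min; apply/orP; right; lra.
have zi : -1 <= z <= 1 by lra.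
rewrite leNgt; apply/negP => lt; move: z4; rewrite leNgt => /negP; apply.
have <- : cos (acos z) = z by rewrite acosK // in_itv.
rewrite ltr_cos // in_itv /=; last by rewrite acos_ge0 // acos_lepi.
lra.
Qed.

Lemma normal_hyperplane (d : nat) (u : 'rV[RR]_d) : u != 0 ->
  exists B : 'M[RR]_(d.-1, d), \rank B = d.-1 /\
    forall w, dotp u w = 0 -> exists z, w = z *m B.
Proof.
move=> u0; have := eq_row_base (kermx u^T); have := row_base_free (kermx u^T).
have rk : \rank (kermx u^T) = d.-1.
  by rewrite mxrank_ker mxrank_tr rank_rV u0 subn1.
move: (row_base _); rewrite rk => B /eqP rB eB.
exists B; split=> // w uw.
have /submxP[z ->] : (w <= B)%MS; last by exists z.
rewrite eB; apply/sub_kermxP; apply/rowP => i; rewrite !mxE ord1.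
by rewrite -[RHS]uw; apply: eq_bigr => j _; rewrite mxE mulrC.
Qed.

Lemma cosine_itv (d : nat) (v w : 'rV[RR]_d) :
  -1 <= dotp v w / (enorm v * enorm w) <= 1.
Proof.
rewrite -ler_norml normrM normfV [`|enorm _ * _|]ger0_norm ?mulr_ge0 ?enorm_ge0 //.
have [->|n0] := eqVneq (enorm v * enorm w) 0; first by rewrite invr0 mulr0.
rewrite ler_pdivrMr ?mul1r ?cauchy_schwarz //.
by rewrite lt0r n0 mulr_ge0 ?enorm_ge0.
Qed.

(** The plane is the hyperplane orthogonal to [u]. A difference [v] has a component of length at
    most [s |v|] along [u], so its projection [w] satisfies [|w| >= (1 - s) |v|]. The cosine of the
    angle between [v] and [w] is [|w| / |v|], and this angle bounds the infimum. *)
Lemma flat_of_normal (d N : nat) (f : 'I_N -> 'rV[RR]_d) (i : 'I_N)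
    (alpha s : RR) (u : 'rV[RR]_d) :
  0 < s < 1 -> (forall z, 1 - s <= z -> z <= 1 -> acos z <= alpha) ->
  u != 0 ->
  (forall q, q != i -> f i != f q /\
     `|dotp u (f i - f q)| <= s * (enorm u * enorm (f i - f q))) ->
  flat_at d.-1 alpha f i.
Proof.
move=> /andP[s0 s1] hs u0 hu; right.
have [B [rB hB]] := normal_hyperplane u0.
exists [set 0 + z *m B | z in [set: 'rV_d.-1]]%classic; split.
  by exists 0, B.
move=> q /hu []; rewrite -subr_eq0; move: (f i - f q) => v v0 hv.
have vp : 0 < enorm v by rewrite enorm_gt0.
have up : 0 < enorm u by rewrite enorm_gt0.
have uu : dotp u u = enorm u ^+ 2 by rewrite enorm_sqr.
pose c := dotp u v / enorm u ^+ 2.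
have cu : c * enorm u ^+ 2 = dotp u v by rewrite /c divfK // sqrf_eq0 lt0r_neq0.
pose w := v - c *: u.
have uw : dotp u w = 0 by rewrite dotpDr dotpNr dotpZr uu cu subrr.
have vw : dotp v w = enorm w ^+ 2.
  by rewrite enorm_sqr -[v in LHS](subrK (c *: u)) dotpDl dotpZl uw mulr0 addr0.
have cE : c ^+ 2 * enorm u ^+ 2 <= s ^+ 2 * enorm v ^+ 2.
  have : (c * enorm u ^+ 2) ^+ 2 <= (s * (enorm u * enorm v)) ^+ 2.
    by rewrite cu -[X in X <= _]real_normK ?num_real // lerXn2r ?nnegrE // !mulr_ge0 ?ltW.
  by move=> h; rewrite -(ler_pM2r (exprn_gt0 2 up)); lra.
have w2 : enorm w ^+ 2 = enorm v ^+ 2 - c ^+ 2 * enorm u ^+ 2.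
  by rewrite -vw /w dotpDr dotpNr dotpZr (dotpC v u) -cu -enorm_sqr; ring.
have wge : (1 - s) * enorm v <= enorm w.
  rewrite -ler_sqr ?nnegrE ?enorm_ge0 ?mulr_ge0 ?(ltW vp) //; last lra.
  rewrite w2 exprMn; apply: (@le_trans _ _ (enorm v ^+ 2 - s ^+ 2 * enorm v ^+ 2)); last lra.
  have := exprn_gt0 2 vp; move: (enorm v ^+ 2) => V Vp.
  have s1' : 0 <= 1 - s by lra.
  have := mulr_ge0 (mulr_ge0 (ltW s0) s1') (ltW Vp); lra.
have wp : 0 < enorm w by apply: lt_le_trans wge; rewrite mulr_gt0 // subr_gt0.
have wv : enorm w <= enorm v.
  rewrite -ler_sqr ?nnegrE ?enorm_ge0 // w2 gerBl.
  by rewrite mulr_ge0 ?sqr_ge0.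
apply: (@le_trans _ _ (vangle v w)).
  apply: ge_inf.
    exists 0 => _ [x _ <-]; apply: acos_ge0; exact: cosine_itv.
  exists w => //; split; last by rewrite -enorm_gt0.
  have [z wz] := hB w uw.
  exists w, 0; split; first by exists z => //; rewrite add0r.
  split; last by rewrite subr0.
  by exists 0 => //; rewrite mul0mx addr0.
have e : dotp v w / (enorm v * enorm w) = enorm w / enorm v.
  by rewrite vw; field; rewrite !lt0r_neq0.
rewrite /vangle e; apply: hs.
  by rewrite ler_pdivlMr.
by rewrite ler_pdivrMr // mul1r.
Qed.

(** The values are raised to at least 2, sorted, and then lowered by distinct amounts to break ties;
    half of [eps] pays for the lowering. *)
Lemma sorted_intervals (k : nat) (t : 'I_k -> RR) (eps : RR) :
  0 < eps ->
  exists t' : 'I_k -> RR, [/\ forall l, 1 <= t' l,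
    forall l l' : 'I_k, (l < l')%N -> t' l < t' l' &
    forall l, exists l', forall x, 2 <= x -> t l <= x -> x <= t l + eps / 2 ->
      t' l' <= x <= t' l' + eps].
Proof.
move=> eps0.
pose r := sort <=%R (codom (fun l => Num.max 2 (t l))).
have sr : size r = k by rewrite size_sort size_codom card_ord.
have rS : sorted <=%R r by apply: sort_sorted; exact: le_total.
pose e := Num.min (eps / 2) 1.
have e0 : 0 < e by rewrite lt_min; apply/andP; split; lra.
have e1 : e <= 1 by rewrite ge_min lexx orbT.
have e2 : e <= eps / 2 by rewrite ge_min lexx.
(* The shift strictly decreases in [l]. Being at most 1 it keeps the values at least 1, and being at
   most [eps / 2] it keeps the intervals long enough. *)
pose sh (l : nat) : RR := e * (1 - l%:R / k%:R).
have shb (l : 'I_k) : 0 <= sh l <= e.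
  have k0 : 0 < k%:R :> RR by rewrite ltr0n; apply: leq_ltn_trans (ltn_ord l).
  have : 0 <= (l%:R / k%:R : RR) <= 1.
    by rewrite divr_ge0 ?ler0n //= ler_pdivrMr // mul1r ler_nat ltnW.
  rewrite /sh; nra.
have r2 (l : 'I_k) : 2 <= r`_l.
  have : r`_l \in r by rewrite mem_nth ?sr.
  by rewrite mem_sort => /codomP[l' ->]; rewrite le_max lexx.
exists (fun l => r`_l - sh l); split.
- by move=> l; have := r2 l; have := shb l; lra.
- move=> l l' ll'.
  have k0 : 0 < k%:R :> RR by rewrite ltr0n; apply: leq_ltn_trans (ltn_ord l).
  have : r`_l <= r`_l'.
    by apply: (le_sorted_leq_nth 0 rS); rewrite ?inE ?sr // ltnW.
  have : sh l' < sh l.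
    rewrite /sh ltr_pM2l // ltrD2l ltrN2 ltr_pM2r ?invr_gt0 //.
    by rewrite ltr_nat.
  lra.
- move=> l.
  have : Num.max 2 (t l) \in r by rewrite mem_sort codom_f.
  move=> /(nthP 0)[m]; rewrite sr => mk em.
  exists (Ordinal mk) => x x2 tx xt /=; rewrite em.
  have := shb (Ordinal mk) => /= hsh.
  have m1 : Num.max 2 (t l) <= x by rewrite ge_max x2.
  have m2 : t l <= Num.max 2 (t l) by rewrite le_max lexx orbT.
  lra.
Qed.

(** A scale-free form of the notion: [s] bounds both the interval length relative to the least
    distance and the cosines with the normals [u], which stand for the hyperplanes. *)
Definition almost_flat_configuration (d k N : nat) (s : RR) : Prop :=
  exists (P : 'I_N -> 'rV[RR]_d) (A0 L : RR) (t : 'I_k -> RR) (E : {set 'I_N}),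
    [/\ 0 < A0 /\ L <= s * A0,
        forall i j, i != j -> A0 <= edist (P i) (P j),
        forall i j, i != j -> exists l, t l <= edist (P i) (P j) <= t l + L,
        (#|E| <= 2)%N &
        forall i, i \notin E -> exists2 u, u != 0 & forall q, q != i ->
          `|dotp u (P i - P q)| <= s * (enorm u * edist (P i) (P q))].

(* If [L] is small compared with the least distance [A0], the set can be rescaled
   by [2 / A0]; the bound [2] on the new distances leaves room for making the
   [t l] strictly increasing and at least [1]. *)
Lemma rescaled_configuration (d k : nat) (eps alpha : RR) :
  0 < eps -> 0 < alpha ->
  exists2 s : RR, 0 < s < 1 & forall N : nat, almost_flat_configuration d k N s ->
    exists f : 'I_N -> 'rV[RR]_d, nearly_kdist k eps f /\ almost_flat d.-1 alpha f.
Proof.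
move=> eps0 alpha0; have [s1 s1b hs1] := acos_small alpha0.
(* Rescaling by [2 / A0] takes [L] to at most [2 s <= eps / 2], the length that [sorted_intervals]
   accepts. *)
pose s := Num.min s1 (eps / 4).
have ss1 : s <= s1 by rewrite ge_min lexx.
have se : s <= eps / 4 by rewrite ge_min lexx orbT.
have s0 : 0 < s by rewrite lt_min; apply/andP; split; lra.
exists s; first by lra.
move=> N [P [A0 [L [t [E [[A00 LA] hA ht E2 hE]]]]]].
pose c := 2 / A0; have c0 : 0 < c by rewrite divr_gt0.
have cA : c * A0 = 2 by rewrite /c divfK // lt0r_neq0.
pose f i := c *: P i.
have fE i j : edist (f i) (f j) = c * edist (P i) (P j).
  by rewrite /edist -scalerBr enormZ gtr0_norm.
have f2 i j : i != j -> 2 <= edist (f i) (f j).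
  by move=> /hA h; rewrite fE -cA ler_pM2l.
have [t' [t1 tlt tcov]] := sorted_intervals (fun l => c * t l) eps0.
exists f; split.
  split; first by move=> i j /f2; apply: le_trans; lra.
  exists t'; split=> // i j ij; have [l /andP[tl1 tl2]] := ht i j ij.
  have [l' hl'] := tcov l; exists l'; apply: hl'; first exact: f2.
    by rewrite fE ler_pM2l.
  rewrite fE; apply: (@le_trans _ _ (c * (t l + L))); first by rewrite ler_pM2l.
  rewrite mulrDr lerD2l.
  have : c * L <= c * (s * A0) by rewrite ler_pM2l.
  rewrite mulrCA cA; lra.
exists E; split=> // i iE; have [u u0 hu] := hE i iE.
apply: (flat_of_normal (s := s1) (u := u)) => // q qi; split.
  apply/negP => /eqP e; have := f2 q i qi; rewrite e /edist subrr.
  have : enorm (0 : 'rV[RR]_d) = 0.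
    by apply/eqP; rewrite eq_le enorm_ge0 andbT leNgt enorm_gt0 eqxx.
  lra.
rewrite -scalerBr dotpZr enormZ normrM gtr0_norm // (mulrCA _ c) (mulrCA _ c).
rewrite ler_pM2l //; apply: le_trans (hu q qi) _.
by rewrite ler_wpM2r ?mulr_ge0 ?enorm_ge0.
Qed.

(** * Flat configurations from many cliques *)

(** With [u = x - y] and [w = y - q], expand [|u + w|^2]. The lengths [|u + w|] and [|w|] differ by
    at most [L], so their squares differ by at most [4 L |w|], and [|u|^2 <= eta |u| |w|]. *)
Lemma move_orthogonal (d : nat) (x y q : 'rV[RR]_d) (T L eta lam : RR) :
  0 <= L -> L <= T ->
  T <= edist y q <= T + L -> T <= edist x q <= T + L ->
  edist x y <= eta * edist y q -> L <= lam * edist x y ->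
  `|dotp (x - y) (y - q)| <= (eta + 4 * lam) * (edist x y * edist y q).
Proof.
rewrite /edist => L0 LT hy; rewrite -(subrKA y x (- q)).
move: (x - y) (y - q) hy => u w /andP[w1 w2] /andP[z1 z2] hu hL.
have : enorm (u + w) ^+ 2 = enorm u ^+ 2 + enorm w ^+ 2 + 2 * dotp u w.
  by rewrite !enorm_sqr dotpDl !dotpDr (dotpC w u); ring.
move: (enorm_ge0 u) (enorm_ge0 w) (dotp u w) w1 w2 z1 z2 hu hL.
move: (enorm u) (enorm w) (enorm (u + w)) => U W Z U0 W0 p w1 w2 z1 z2 hu hL e.
have e2 : 2 * p = (Z - W) * (Z + W) - U ^+ 2 by lra.
have b1 : `|(Z - W) * (Z + W)| <= L * (4 * W).
  rewrite normrM ler_pM // ?normr_ge0 // ler_norml; apply/andP; split; lra.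
have b2 : U ^+ 2 <= eta * W * U by rewrite expr2 ler_wpM2r.
have b3 : L * (4 * W) <= lam * U * (4 * W) by rewrite ler_wpM2r // mulr_ge0.
have b4 := sqr_ge0 U.
move: b1; rewrite !ler_norml => /andP[b1 b1'].
apply/andP; split; lra.
Qed.

(** Replacing [q] by [q'] adds an error [eta |u| |y - q|], and [|y - q| <= 2 |y - q'|]. This carries
    flatness over to a point close to a vertex. *)
Lemma near_orthogonal (d : nat) (u y q q' : 'rV[RR]_d) (sig eta : RR) :
  0 <= sig -> 0 <= eta -> eta <= 2^-1 ->
  edist q q' <= eta * edist y q ->
  `|dotp u (y - q)| <= sig * (enorm u * edist y q) ->
  `|dotp u (y - q')| <= 2 * (sig + eta) * (enorm u * edist y q').
Proof.
move=> sig0 eta0 eta2 hq hu.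
have -> : y - q' = (y - q) + (q - q') by rewrite subrKA.
have t1 := cauchy_schwarz u (q - q').
have t2 := edist_triangle y q' q; rewrite (edistC q' q) in t2.
have W2 : edist y q <= 2 * edist y q'.
  have : eta * edist y q <= 2^-1 * edist y q by rewrite ler_wpM2r ?enorm_ge0.
  lra.
rewrite dotpDr; apply: le_trans (ler_normD _ _) _.
have U0 := enorm_ge0 u.
apply: (@le_trans _ _ ((sig + eta) * (enorm u * edist y q))).
  have : enorm u * edist q q' <= enorm u * (eta * edist y q) by rewrite ler_wpM2l.
  move: t1 hu; rewrite -/(edist q q'); lra.
have : (sig + eta) * (enorm u * edist y q) <= (sig + eta) * (enorm u * (2 * edist y q')).
  by rewrite ler_wpM2l ?addr_ge0 // ler_wpM2l.
lra.
Qed.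

(* For every other point of the configuration: the interval containing the distance
   to it, and a grid cell around it, fine on the scale of that distance. *)
Definition configuration_class (k d N Q : nat) : finType :=
  {ffun 'I_N -> 'I_k * {ffun 'I_d -> 'I_Q.+1}}.

(** [exists_good_tuple] with [far] meaning distance at least [a x]: by [packing], a set without far
    pairs has at most [(3 d a)^d n] points, so a small [a] makes bad tuples few. Equal classes give
    equal intervals and closeness, and [move_orthogonal] applies. *)
Lemma good_configuration (d k n N Q : nat) (f : 'I_n -> 'rV[RR]_d)
    (t : 'I_k -> RR) (a x L eta delta : RR) (adj : rel 'I_n)
    (col : 'I_n -> 'I_n -> 'I_k) (X : {set N.-tuple 'I_n}) (I : {set 'I_N}) :
  (0 < d)%N -> separated f -> x ^+ d = n%:R -> 0 < a -> 1 <= a * x ->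
  0 < eta -> 4 * d%:R < Q.+1%:R * eta ->
  symmetric adj -> 0 <= L -> L <= eta * (a * x) ->
  (forall p q, adj p q -> [/\ 0 < t (col p q), L <= t (col p q) &
     t (col p q) <= edist (f p) (f q) <= t (col p q) + L]) ->
  (forall i g y, i \in I -> g \in X -> replace g i y \in X) ->
  (0 < #|X|)%N ->
  delta * #|X|%:R <= #|[set g in X | pairwise adj g]|%:R ->
  N%:R * #|configuration_class k d N Q|%:R * (3 * d%:R * a) ^+ d < delta ->
  exists2 g : N.-tuple 'I_n, pairwise adj g & forall i, i \in I -> exists y,
    [/\ pairwise adj (replace g i y), a * x <= edist (f y) (f (tnth g i)) &
        forall j, j != i ->
          edist (f y) (f (tnth g i)) <= eta * edist (f (tnth g i)) (f (tnth g j)) /\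
          `|dotp (f y - f (tnth g i)) (f (tnth g i) - f (tnth g j))| <=
          5 * eta * (edist (f y) (f (tnth g i)) * edist (f (tnth g i)) (f (tnth g j)))].
Proof.
move=> d0 sf xn a0 ax1 eta0 hQ sym L0 Lax hadj Xr X0 hW hsmall.
have dR : 0 < d%:R :> RR by rewrite ltr0n.
(* The radius is [2 t l] because an edge of colour [l] has length at most [t l + L <= 2 t l]; the
   side [eta t l / d] makes cells of diameter below [eta t l]. *)
have cellE q l : exists cell : 'rV[RR]_d -> {ffun 'I_d -> 'I_Q.+1}, 0 < t l ->
    forall v w, edist v (f q) <= 2 * t l -> edist w (f q) <= 2 * t l ->
    cell v = cell w -> edist v w < eta * t l.
  have [tl0|] := ltP 0 (t l); last by exists (fun _ => [ffun => ord0]).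
  have h0 : 0 < eta * t l / d%:R by rewrite divr_gt0 // mulr_gt0.
  have [|cell hc] := @grid d Q (2 * t l) (eta * t l / d%:R) (f q) d0 h0.
    rewrite [X in _ < X]mulrA ltr_pdivlMr //.
    have := hQ; rewrite -(ltr_pM2r tl0); lra.
  exists cell => _ v w hv hw /(hc _ _ hv hw).
  by rewrite mulrC divfK // lt0r_neq0.
pose F q l := sval (cid (cellE q l)).
have FP q l : 0 < t l -> forall v w, edist v (f q) <= 2 * t l ->
    edist w (f q) <= 2 * t l -> F q l v = F q l w -> edist v w < eta * t l.
  exact: (svalP (cid (cellE q l))).
(* The value at [j = i] makes the class independent of the [i]-th entry of [g], as
   [exists_good_tuple] demands. *)
pose oth (i : 'I_N) (g : N.-tuple 'I_n) (y : 'I_n) (j : 'I_N) :=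
  if j == i then y else tnth g j.
pose cls i g y : configuration_class k d N Q :=
  [ffun j => (col y (oth i g y j), F (oth i g y j) (col y (oth i g y j)) (f y))].
pose far y z := a * x <= edist (f y) (f z).
pose P := Num.truncn ((3 * d%:R * (a * x)) ^+ d).
have Pge0 : 0 <= (3 * d%:R * (a * x)) ^+ d.
  by rewrite exprn_ge0 // mulr_ge0 //; lra.
have [|||||g] := @exists_good_tuple 'I_n (configuration_class k d N Q) N P X
  [set g in X | pairwise adj g] I cls far.
- by apply/fintype.subsetP => g; rewrite inE => /andP[].
- exact: Xr.
- move=> i g y z; apply/ffunP => j; rewrite !ffunE /oth tnth_replace.
  by case: (j == i).
- move=> S hS; rewrite truncn_ge_nat //.
  have [->|/finset.set0Pn[p pS]] := eqVneq S finset.set0; first by rewrite cards0.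
  apply: (@packing d n f p (a * x) S) => // y yS.
  by have := hS y p yS pS; rewrite /far -ltNge => /ltW.
- rewrite card_ord -(ltr_nat RR) !natrM.
  have n0 : 0 < n%:R :> RR.
    by rewrite -xn exprn_gt0 // -(pmulr_rgt0 _ a0); lra.
  have XR : 0 < #|X|%:R :> RR by rewrite ltr0n.
  have hP : P%:R <= (3 * d%:R * a) ^+ d * n%:R.
    by rewrite -xn -exprMn -(mulrA (3 * d%:R)) truncn_le.
  have hN : 0 <= N%:R * #|configuration_class k d N Q|%:R :> RR.
    by rewrite mulr_ge0 // ler0n.
  have m1 := ler_wpM2l hN hP.
  have m2 : N%:R * #|configuration_class k d N Q|%:R * (3 * d%:R * a) ^+ d * n%:R
     < delta * n%:R by rewrite ltr_pM2r.
  have m3 : (N%:R * #|configuration_class k d N Q|%:R * P%:R) * #|X|%:R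
     < delta * n%:R * #|X|%:R.
    by rewrite ltr_pM2r //; apply: le_lt_trans m1 _; rewrite mulrA.
  have m4 := ler_wpM2l (ltW n0) hW.
  move: m3 m4; lra.
rewrite inE => /andP[gX gadj] hg; exists g => // i iI.
have [y [yW yc yfar]] := hg i iI; exists y.
move: yW; rewrite inE => /andP[_ yadj]; split=> //.
  by rewrite edistC.
move=> j ji.
have /(congr1 (fun c : configuration_class k d N Q => c j)) := yc.
rewrite !ffunE /oth (negPf ji) => -[ec]; rewrite ec => eF.
have ij : i != j by rewrite eq_sym.
have adj1 := pairwise_tnth_sym sym gadj ij.
have := pairwise_tnth_sym sym yadj ij; rewrite !tnth_replace eqxx (negPf ji) => adj2.
have [t0 Lt /andP[d1 d2]] := hadj _ _ adj1.
have [_ _] := hadj _ _ adj2; rewrite ec => /andP[e1 e2].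
have near : edist (f y) (f (tnth g i)) <= eta * edist (f (tnth g i)) (f (tnth g j)).
  apply: (@le_trans _ _ (eta * t (col (tnth g i) (tnth g j)))).
    by apply/ltW/(FP _ _ t0 _ _ _ _ eF); lra.
  by rewrite ler_pM2l.
split=> //; rewrite (_ : 5 * eta = eta + 4 * eta); last by ring.
apply: (move_orthogonal L0 Lt _ _ near); first exact/andP.
  exact/andP.
by apply: le_trans Lax _; rewrite ler_pM2l // edistC.
Qed.

Lemma card_set_prefix2 (V : finType) (m : nat) (p q : V) (Q : pred (seq V)) :
  #|[set g : m.+2.-tuple V | [&& tnth g ord0 == p, tnth g (lift ord0 ord0) == q & Q g]]| =
  #|[set t : m.-tuple V | Q [:: p, q & t]]|.
Proof.
have inj : injective (fun t : m.-tuple V => [tuple of [:: p, q & t]]).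
  by move=> t1 t2 /(congr1 val) /= [] e; apply: val_inj.
rewrite -(card_imset _ inj); apply: eq_card => g; rewrite !inE.
apply/idP/imsetP => [|[t]]; last by rewrite inE => Qt ->; apply/and3P; split.
move: g => [[|a [|b r]] sz] //= /and3P[/eqP + /eqP +]; rewrite /tnth /= => -> -> Qr.
have sr : size r == m by move: sz; rewrite /= !eqSS.
exists (Tuple sr); first by rewrite inE.
exact: val_inj.
Qed.

(** Positions 0 and 1 hold [p] and [q] and never vary, so they form the exceptional set [~: I];
    elsewhere the displacement of the vertex serves as the normal. *)
Lemma configuration_of_heavy_edge (d k n m Q : nat) (f : 'I_n -> 'rV[RR]_d)
    (t : 'I_k -> RR) (a x L s delta : RR) (adj : rel 'I_n)
    (col : 'I_n -> 'I_n -> 'I_k) (p q : 'I_n) :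
  (0 < d)%N -> separated f -> x ^+ d = n%:R -> 0 < a -> 1 <= a * x ->
  0 < s -> 4 * d%:R < Q.+1%:R * (s / 16) ->
  symmetric adj -> 0 <= L -> L <= s / 16 * (a * x) ->
  (forall p q, adj p q -> [/\ a * x <= t (col p q), L <= t (col p q) &
     t (col p q) <= edist (f p) (f q) <= t (col p q) + L]) ->
  delta * n%:R ^+ m <= #|[set g : m.-tuple 'I_n | pairwise adj [:: p, q & g]]|%:R ->
  m.+2%:R * #|configuration_class k d m.+2 Q|%:R * (3 * d%:R * a) ^+ d < delta ->
  almost_flat_configuration d k m.+2 s.
Proof.
move=> d0 sf xn a0 ax1 s0 hQ sym L0 Ls hadj hm hsmall.
have ax0 : 0 < a * x by lra.
pose X : {set m.+2.-tuple 'I_n} :=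
  [set g | [&& tnth g ord0 == p, tnth g (lift ord0 ord0) == q & true]].
pose I := [set i : 'I_m.+2 | (1 < i)%N].
have cX : #|X| = (n ^ m)%N.
  rewrite (card_set_prefix2 m p q predT) -[n in RHS]card_ord -card_tuple -cardsT.
  by apply: eq_card => g; rewrite !inE.
have eta0 : 0 < s / 16 by lra.
have [|i g y|||g gadj hg] := good_configuration (X := X) (I := I) (delta := delta)
  d0 sf xn a0 ax1 eta0 hQ sym L0 Ls (t := t) (col := col) _ _ _ _ hsmall.
- by move=> p' q' /hadj[h1 h2 h3]; split=> //; lra.
- rewrite !inE !andbT !tnth_replace => i1.
  have -> : (ord0 == i) = false by apply/eqP => e; rewrite -e in i1.
  by have -> : (lift ord0 ord0 == i) = false by apply/eqP => e; rewrite -e in i1.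
- rewrite cX expn_gt0 (leq_ltn_trans _ (ltn_ord p)) //.
- rewrite cX natrX; apply: le_trans hm _; rewrite ler_nat.
  rewrite -(card_set_prefix2 m p q (pairwise adj)).
  by apply: subset_leq_card; apply/fintype.subsetP => g; rewrite !inE andbT andbA.
exists (fun i => f (tnth g i)), (a * x), L, t, (~: I); split.
- by split=> //; apply: le_trans Ls _; rewrite ler_pM2r //; lra.
- move=> i j ij; have [h1 _ /andP[h2 _]] := hadj _ _ (pairwise_tnth_sym sym gadj ij).
  exact: le_trans h2.
- move=> i j ij; have [_ _ h] := hadj _ _ (pairwise_tnth_sym sym gadj ij).
  by exists (col (tnth g i) (tnth g j)).
- apply: (@leq_trans #|[set ord0; (inord 1 : 'I_m.+2)]|); last by rewrite cards2; case: eqP.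
  apply: subset_leq_card; apply/fintype.subsetP => i; rewrite !inE -leqNgt.
  by case: i => -[|[|i]] hi //= _; rewrite -!val_eqE /= inordK.
- move=> i; rewrite inE negbK => /hg[y [_ yfar yj]]; exists (f y - f (tnth g i)).
    by rewrite -enorm_gt0; apply: lt_le_trans ax0 yfar.
  move=> j /yj[_ h]; apply: le_trans h _; rewrite ler_wpM2r ?mulr_ge0 ?enorm_ge0 //; lra.
Qed.

(* The colour [l0] is unused, so the distance between [g_0] and its replacement may
   be taken as the new value of [t l0]. *)
Lemma configuration_of_many_cliques (d k n m Q : nat) (f : 'I_n -> 'rV[RR]_d)
    (t : 'I_k -> RR) (a x L s delta : RR) (adj : rel 'I_n)
    (col : 'I_n -> 'I_n -> 'I_k) (l0 : 'I_k) :
  (0 < d)%N -> (0 < n)%N -> separated f -> x ^+ d = n%:R -> 0 < a -> 1 <= a * x ->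
  0 < s < 1 -> 4 * d%:R < Q.+1%:R * (s / 16) ->
  symmetric adj -> 0 <= L -> L <= s / 16 * (a * x) ->
  (forall p q, adj p q -> [/\ col p q != l0, a * x <= t (col p q), L <= t (col p q) &
     t (col p q) <= edist (f p) (f q) <= t (col p q) + L]) ->
  delta * n%:R ^+ m.+1 <= #|[set g : m.+1.-tuple 'I_n | pairwise adj g]|%:R ->
  m.+1%:R * #|configuration_class k d m.+1 Q|%:R * (3 * d%:R * a) ^+ d < delta ->
  almost_flat_configuration d k m.+2 s.
Proof.
move=> d0 n0 sf xn a0 ax1 /andP[s0 s1] hQ sym L0 Ls hadj hm hsmall.
have ax0 : 0 < a * x by lra.
have eta0 : 0 < s / 16 by lra.
have [||||g gadj hg] := good_configuration (X := [set: m.+1.-tuple 'I_n])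
  (I := [set: 'I_m.+1]) (delta := delta)
  d0 sf xn a0 ax1 eta0 hQ sym L0 Ls (t := t) (col := col) _ _ _ _ hsmall.
- by move=> p' q' /hadj[_ h1 h2 h3]; split=> //; lra.
- by move=> *; rewrite inE.
- by rewrite cardsT card_tuple card_ord expn_gt0 n0.
- rewrite cardsT card_tuple card_ord natrX; apply: le_trans hm _; rewrite ler_nat.
  by apply: subset_leq_card; apply/fintype.subsetP => g; rewrite !inE.
have [y0 [y0adj y0far y0near]] := hg ord0 (finset.in_setT _).
pose P (i : 'I_m.+2) := if unlift ord0 i is Some j then f (tnth g j) else f y0.
pose t' l := if l == l0 then edist (f y0) (f (tnth g ord0)) else t l.
have Pl j : P (lift ord0 j) = f (tnth g j) by rewrite /P liftK.
have P0 : P ord0 = f y0 by rewrite /P unlift_none.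
have hcol u v : adj u v -> a * x <= edist (f u) (f v) /\
    exists l, t' l <= edist (f u) (f v) <= t' l + L.
  move=> /hadj[h0 h1 h2 h3]; split; first by case/andP: h3 => h3 _; exact: le_trans h3.
  by exists (col u v); rewrite /t' (negPf h0).
have hnew : a * x <= edist (f y0) (f (tnth g ord0)) /\
    exists l, t' l <= edist (f y0) (f (tnth g ord0)) <= t' l + L.
  by split=> //; exists l0; rewrite /t' eqxx lexx lerDl.
have main i j : i != j -> a * x <= edist (P i) (P j) /\
    exists l, t' l <= edist (P i) (P j) <= t' l + L.
  have y0j (j' : 'I_m.+1) : a * x <= edist (f y0) (f (tnth g j')) /\
    exists l, t' l <= edist (f y0) (f (tnth g j')) <= t' l + L.
    have [->//|j0] := eqVneq j' ord0; apply: hcol.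
    have := @pairwise_tnth_sym _ adj _ _ ord0 j' sym y0adj.
    by rewrite !tnth_replace eqxx (negPf j0) eq_sym j0; apply.
  case: (unliftP ord0 i) => [i' ->|->]; case: (unliftP ord0 j) => [j' ->|->];
    rewrite ?Pl ?P0 ?eqxx // => ij; last by rewrite edistC.
  by apply/hcol/pairwise_tnth_sym => //; apply: contraNneq ij => ->.
(* The exceptional points are [y0] and the vertex [g_0] it replaces: the normal [y0 - g_0] is
   parallel to their difference. *)
exists P, (a * x), L, t', [set ord0; lift ord0 ord0]; split.
- by split=> //; apply: le_trans Ls _; rewrite ler_pM2r //; lra.
- by move=> i j /main[].
- by move=> i j /main[].
- by rewrite cards2; case: eqP.
- move=> i; rewrite !inE negb_or => /andP[].
  case: (unliftP ord0 i) => [i' ->|->]; last by rewrite eqxx.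
  move=> _; rewrite (inj_eq lift_inj) => i0.
  have [y [_ yfar yj]] := hg i' (finset.in_setT _); exists (f y - f (tnth g i')).
    by rewrite -enorm_gt0; apply: lt_le_trans ax0 yfar.
  move=> q; case: (unliftP ord0 q) => [q' ->|->] qi; rewrite ?Pl ?P0.
    have [|_ h] := yj q'; first by apply: contraNneq qi => ->.
    by apply: le_trans h _; rewrite ler_wpM2r ?mulr_ge0 ?enorm_ge0 //; lra.
  (* Near-orthogonality to the difference with [g_0] passes to the nearby [y0]; the error
     [2 (5 + 1) s / 16] stays below [s], which is why [eta = s / 16]. *)
  have [|_ h] := yj ord0; first by rewrite eq_sym.
  have [h' _] := y0near i' i0.
  apply: le_trans (near_orthogonal (sig := 5 * (s / 16)) (eta := s / 16) _ _ _ _ h) _;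
    try lra.
    by rewrite edistC [edist (f (tnth g i')) _]edistC.
  by rewrite ler_wpM2r ?mulr_ge0 ?enorm_ge0 //; lra.
Qed.

(** * The bound on the number of edges *)

Lemma degree_sum_pairs (n : nat) (adj : rel 'I_n) :
  symmetric adj -> irreflexive adj ->
  degree_sum adj [set: 'I_n] =
  (2 * #|[set ij : 'I_n * 'I_n | (ij.1 < ij.2)%N && adj ij.1 ij.2]|)%N.
Proof.
move=> sym irr.
have e : #|[set ij : 'I_n * 'I_n | (ij.1 < ij.2)%N && adj ij.1 ij.2]| =
  (\sum_(i < n) \sum_(j < n) ((i < j) && adj i j))%N.
  rewrite -sum1_card pair_big /= [LHS]big_mkcond /=.
  by apply: eq_bigr => ij _; rewrite inE; case: (_ && _).
rewrite mul2n -addnn {2}e exchange_big /= e -big_split /=.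
rewrite /degree_sum; apply: eq_big => [i|i _]; first by rewrite inE.
rewrite -big_split /= -sum1_card big_mkcond /=; apply: eq_bigr => j _.
rewrite !inE /= (sym j i); case: ltngtP => [_|_|/ord_inj->]; rewrite ?irr //=.
by case: (adj i j).
Qed.

Lemma Tturan_le (n s : nat) : (0 < s)%N ->
  (Tturan n s)%:R <= (1 - (s%:R)^-1) * (n%:R ^+ 2 / 2) :> RR.
Proof.
move=> s0; have sR : 0 < s%:R :> RR by rewrite ltr0n.
have : (2 * s * Tturan n s <= s.-1 * n ^ 2)%N by rewrite -(Tturan_exact n s0) leq_addr.
rewrite -(ler_nat RR) !natrM -subn1 natrB // => h.
rewrite -(ler_pM2l (x := 2 * s%:R)) ?mulr_gt0 //.
apply: le_trans h _; rewrite le_eqVlt; apply/orP; left; apply/eqP.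
by field; rewrite lt0r_neq0.
Qed.

(** If [3 d b <= m <= 1] then [(3 d b)^d <= m], and [K m < delta] for [m] at most
    [delta / (K + 1)]. *)
Lemma small_power (d : nat) (K delta : RR) :
  (0 < d)%N -> 0 <= K -> 0 < delta ->
  exists2 a : RR, 0 < a & forall b, 0 <= b -> b <= a ->
    K * (3 * d%:R * b) ^+ d < delta.
Proof.
move=> d0 K0 delta0; have dR : 0 < 3 * d%:R :> RR by rewrite mulr_gt0 // ltr0n.
have K1 : 0 < K + 1 by lra.
pose m := Num.min 1 (delta / (K + 1)).
have m0 : 0 < m by rewrite lt_min ltr01 divr_gt0.
have m1 : m <= 1 by rewrite ge_min lexx.
exists (m / (3 * d%:R)); first by rewrite divr_gt0.
move=> b b0; rewrite ler_pdivlMr // mulrC => bm.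
have h0 : 0 <= 3 * d%:R * b by rewrite mulr_ge0 // ltW.
have h1 : (3 * d%:R * b) ^+ d <= m.
  apply: le_trans (bm); rewrite -[X in _ <= X]expr1.
  by apply: ler_wiXn2l => //; apply: le_trans bm m1.
apply: (@le_lt_trans _ _ (K * m)); first by rewrite ler_wpM2l.
apply: (@lt_le_trans _ _ ((K + 1) * m)); first by rewrite ltr_pM2r //; lra.
have : m <= delta / (K + 1) by rewrite ge_min lexx orbT.
by rewrite ler_pdivlMr // mulrC.
Qed.

(** By [packing], each vertex loses at most [(3 d rho)^d] neighbours. *)
Lemma degree_sum_far (d n : nat) (f : 'I_n -> 'rV[RR]_d) (adj : rel 'I_n) (rho : RR) :
  (0 < d)%N -> separated f -> 1 <= rho ->
  (degree_sum adj [set: 'I_n])%:R <=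
  (degree_sum (fun p q => adj p q && (rho < edist (f p) (f q))) [set: 'I_n])%:R +
  n%:R * (3 * d%:R * rho) ^+ d :> RR.
Proof.
move=> d0 sf rho1.
have h1 : (degree_sum adj [set: 'I_n] <=
  degree_sum (fun p q => adj p q && (rho < edist (f p) (f q))%R) [set: 'I_n] +
  \sum_(p in [set: 'I_n]) #|[set q | (edist (f q) (f p) <= rho)%R]|)%N.
  rewrite -big_split /=; apply: leq_sum => p _.
  apply: leq_trans (leq_card_setU _ _); apply: subset_leq_card.
  apply/fintype.subsetP => q; rewrite !inE => /= -> /=.
  by rewrite edistC; case: ltP.
have h2 : (\sum_(p in [set: 'I_n]) #|[set q | (edist (f q) (f p) <= rho)%R]|)%N%:R
    <= n%:R * (3 * d%:R * rho) ^+ d :> RR.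
  rewrite natr_sum.
  apply: (@le_trans _ _ (\sum_(p in [set: 'I_n]) (3 * d%:R * rho) ^+ d)).
    by apply: ler_sum => p _; apply: (@packing d n f p rho) => // y; rewrite inE.
  by rewrite sumr_const cardsT card_ord -[X in X <= _]mulr_natl.
by move: h1; rewrite -(ler_nat RR) natrD => /le_trans; apply; rewrite lerD2l.
Qed.

(** All constants are fixed before the point set. Too many edges yield the excluded configuration,
    whether or not all [t l] are at least [K x / 2]. *)
Lemma achievable_le_Tturan (d k m : nat) (s : RR) :
  (0 < d)%N -> (0 < k)%N -> 0 < s < 1 ->
  ~ almost_flat_configuration d k m.+2 s ->
  exists2 c : RR, 0 < c & exists n0 : nat, forall (n : nat) (x L : RR) (M : nat),
    (n0 <= n)%N -> 0 <= x -> x ^+ d = n%:R -> 0 <= L -> L <= c * x ->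
    achievable k d n L M -> (M <= Tturan n m.+1)%N.
Proof.
move=> d0 k0 s01 noconf; have /andP[s0 s1] := s01.
pose A : nat := m.+1.
(* With this [K], dropping all pairs at distance at most [K x] lowers the degree sum by at most
   [n^2 / (8 A^2)], the loss that [many_cliques] tolerates. *)
have [K K0 hK] := small_power d0 (ler0n RR (8 * A ^ 2)) ltr01.
pose Q := Num.truncn (4 * d%:R / (s / 16)).
have hQ : 4 * d%:R < Q.+1%:R * (s / 16).
  by rewrite -ltr_pdivrMr ?truncnS_gt //; lra.
pose c1 : RR := A.+1%:R * #|configuration_class k d A.+1 Q|%:R.
pose c2 : RR := A%:R * #|configuration_class k d A Q|%:R.
have c10 : 0 <= c1 by rewrite mulr_ge0 ?ler0n.
have c20 : 0 <= c2 by rewrite mulr_ge0 ?ler0n.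
(* The reciprocals of [e1] and [e2] are the clique densities from [heavy_edge] and
   [many_cliques]. *)
pose e1 : nat := ((80 * A ^ 2 * A.+1) ^ m)%N.
pose e2 : nat := ((80 * A ^ 2) ^ A)%N.
have e10 : 0 < e1%:R :> RR by rewrite ltr0n expn_gt0.
have e20 : 0 < e2%:R :> RR by rewrite ltr0n expn_gt0.
have [|a' a'0 ha'] := @small_power d (c1 + c2) (Num.min e1%:R^-1 e2%:R^-1) d0
  (addr_ge0 c10 c20).
  by rewrite lt_min !invr_gt0 e10 e20.
(* The bound [K / 2] turns [K x / 2 <= t l] into [a x <= t l] and ensures [L <= K x / 2]. *)
pose a := Num.min a' (K / 2).
have a0 : 0 < a by rewrite lt_min a'0 divr_gt0.
have aK : a <= K / 2 by rewrite ge_min lexx orbT.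
have ha : (c1 + c2) * (3 * d%:R * a) ^+ d < Num.min e1%:R^-1 e2%:R^-1.
  by apply: ha'; [exact: ltW | rewrite ge_min lexx].
have ad0 : 0 <= (3 * d%:R * a) ^+ d.
  by rewrite exprn_ge0 // !mulr_ge0 ?ler0n // ltW.
have ha1 : c1 * (3 * d%:R * a) ^+ d < e1%:R^-1.
  move: ha; rewrite lt_min => /andP[h _]; apply: le_lt_trans h.
  by rewrite ler_wpM2r // lerDl.
have ha2 : c2 * (3 * d%:R * a) ^+ d < e2%:R^-1.
  move: ha; rewrite lt_min => /andP[_ h]; apply: le_lt_trans h.
  by rewrite ler_wpM2r // lerDr.
exists (s / 16 * a); first by rewrite mulr_gt0 //; lra.
(* The first bound serves the clique counts; the second gives [a x >= 1], as [packing] requires. *)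
exists (maxn (40 * A ^ 3).+1 (Num.truncn (a ^- d)).+1).
move=> n x L M; rewrite geq_max => /andP[nA na] x0 xn L0 Lx [f [t [sf _ _ hM]]].
have n0 : (0 < n)%N by apply: leq_ltn_trans nA.
have ax1 : 1 <= a * x.
  rewrite mulrC -ler_pdivrMr // div1r.
  rewrite -(ler_pXn2r d0) ?nnegrE ?invr_ge0 ?(ltW a0) // xn exprVn.
  by apply: ltW; apply: lt_le_trans (truncnS_gt _) _; rewrite ler_nat.
have Kx1 : 1 <= K * x by apply: le_trans ax1 _; rewrite ler_wpM2r //; lra.
have axK : a * x <= K / 2 * x by rewrite ler_wpM2r.
have Lax : L <= s / 16 * (a * x) by rewrite mulrA.
have LK : L <= K / 2 * x.
  apply: le_trans Lax _; apply: le_trans axK; rewrite ler_piMl //; lra.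
pose l1 : 'I_k := Ordinal k0.
pose E p q := (p != q) && [exists l : 'I_k, (t l <= edist (f p) (f q)) &&
                        (edist (f p) (f q) <= t l + L)].
have Esym : symmetric E.
  by move=> p q; rewrite /E eq_sym (edistC (f p)).
have Eirr : irreflexive E by move=> p; rewrite /E eqxx.
pose col p q := odflt l1 [pick l | (t l <= edist (f p) (f q)) &&
                        (edist (f p) (f q) <= t l + L)].
have colP p q : E p q -> t (col p q) <= edist (f p) (f q) <= t (col p q) + L.
  rewrite /E /col => /andP[_ /existsP[l hl]].
  by case: pickP => [//|/(_ l)]; rewrite hl.
have ET : (2 * M <= degree_sum E [set: 'I_n])%N.
  rewrite degree_sum_pairs // leq_mul2l /=; apply: leq_trans hM _.
  apply: subset_leq_card; apply/fintype.subsetP => ij; rewrite inE => /set_mem.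
  move=> /= /andP[ij1 hl]; rewrite ij1 /=; apply/andP; split=> //.
  by rewrite -val_eqE /= neq_ltn ij1.
rewrite leqNgt; apply/negP => TM.
have ET' : (2 * Tturan n A < degree_sum E [set: 'I_n])%N.
  by apply: leq_trans ET; rewrite ltn_mul2l.
have [/forallP tK|] := boolP [forall l, K / 2 * x <= t l].
  have [||p [q hpq]] := @heavy_edge 'I_n E A Esym Eirr isT; rewrite ?card_ord //.
  rewrite card_ord in hpq.
  apply: noconf; apply: (@configuration_of_heavy_edge d k n m Q f t a x L s e1%:R^-1
    E col p q) => //.
  - move=> p' q' /colP h; split=> //; first exact: le_trans axK (tK _).
    exact: le_trans LK (tK _).
  - by rewrite mulrC ler_pdivrMr // mulrC -natrX -natrM ler_nat.
rewrite negb_forall => /existsP[l0]; rewrite -ltNge => tl0.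
(* Edges of [F] are too long for the interval of [l0], which ends at [t l0 + L < K x]. *)
pose F p q := E p q && (K * x < edist (f p) (f q)).
have Fsym : symmetric F by move=> p q; rewrite /F Esym edistC.
have Firr : irreflexive F by move=> p; rewrite /F Eirr.
have hF : (8 * A ^ 2 * (2 * Tturan n A) <= 8 * A ^ 2 * degree_sum F [set: 'I_n] + n ^ 2)%N.
  apply: leq_trans (leq_mul (leqnn _) (ltnW ET')) _.
  rewrite -(ler_nat RR) natrD [X in X <= _]natrM [X in _ <= X + _]natrM.
  have := degree_sum_far E d0 sf Kx1; rewrite -/F => h.
  have A0 : 0 <= (8 * A ^ 2)%:R :> RR by exact: ler0n.
  apply: le_trans (ler_wpM2l A0 h) _; rewrite mulrDr lerD2l.
  rewrite (mulrA _ K) exprMn xn mulrCA natrX expr2 ler_wpM2l ?ler0n // mulrA.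
  rewrite ler_piMl ?ler0n //; apply: ltW; apply: hK => //; exact: ltW.
apply: noconf; apply: (@configuration_of_many_cliques d k n m Q f t a x L s e2%:R^-1
    F col l0) => //.
- move=> p q /andP[/colP /andP[h1 h2] h3].
  have tc : K / 2 * x <= t (col p q).
    have Kx : K * x = 2 * (K / 2 * x) by field.
    move: h2 h3 LK; rewrite Kx; lra.
  split; first by apply/eqP => e; move: tc; rewrite e; lra.
  - exact: le_trans axK tc.
  - exact: le_trans LK tc.
  - by apply/andP.
have := @many_cliques 'I_n F A Fsym Firr isT; rewrite card_ord => /(_ nA hF) h.
by rewrite mulrC ler_pdivrMr // mulrC -natrX -natrM ler_nat.
Qed.

(** A single point is admissible: it has no distances, and it can be taken as exceptional. *)
Lemma A_adm_pos (d k A : nat) : is_Ak k d d.-1 A -> (0 < A)%N.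
Proof.
case=> _; apply => eps alpha eps0 alpha0; exists (fun _ => 0); split.
  split=> [i j|]; first by rewrite !ord1 eqxx.
  exists (fun l : 'I_k => 1 + l%:R); split=> [l|l l' ll'|i j].
  - by rewrite lerDl ler0n.
  - by rewrite ltrD2l ltr_nat.
  - by rewrite !ord1 eqxx.
exists [set: 'I_1]; split; first by rewrite cardsT card_ord.
by move=> i; rewrite inE.
Qed.

Theorem theorem11 (d k A : nat) :
  (2 <= d)%N -> (1 <= k)%N -> is_Ak k d d.-1 A ->
  (exists n0 : nat, forall n : nat, (n0 <= n)%N ->
     (Mk k d n 1%R <= Tturan n A)%N /\
     ((Tturan n A)%:R <= (1 - (A%:R)^-1) * (n%:R ^+ 2 / 2) :> RR)) /\
  (exists c : RR, 0 < c /\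
     exists n0 : nat, forall n : nat, (n0 <= n)%N ->
       (Mk k d n (c * powR n%:R (d%:R^-1))%R <= Tturan n A)%N /\
       ((Tturan n A)%:R <= (1 - (A%:R)^-1) * (n%:R ^+ 2 / 2) :> RR)).
Proof.
move=> d2 k0 hA; have A0 := A_adm_pos hA; have d0 : (0 < d)%N by apply: leq_trans d2.
have [m Am] : exists m, A = m.+1 by exists A.-1; rewrite prednK.
(* By maximality of [A], sets of [A.+1] points are missing for some fixed [eps] and [alpha]. *)
have [eps [alpha [eps0 alpha0 noadm]]] : exists eps alpha : RR,
    [/\ 0 < eps, 0 < alpha & ~ exists f : 'I_A.+1 -> 'rV[RR]_d,
      nearly_kdist k eps f /\ almost_flat d.-1 alpha f].
  apply: contrapT => h; have := hA.2 A.+1; rewrite ltnn => /(_ _)/notF; apply.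
  move=> eps alpha eps0 alpha0; apply: contrapT => hf; apply: h.
  by exists eps, alpha.
have [s s01 hs] := @rescaled_configuration d k eps alpha eps0 alpha0.
have [c c0 [n0 hc]] : exists2 c : RR, 0 < c & exists n0 : nat,
    forall (n : nat) (x L : RR) (M : nat),
    (n0 <= n)%N -> 0 <= x -> x ^+ d = n%:R -> 0 <= L -> L <= c * x ->
    achievable k d n L M -> (M <= Tturan n A)%N.
  rewrite Am; apply: (achievable_le_Tturan d0 k0 s01) => /hs.
  by rewrite -Am.
have xn (n : nat) : (powR n%:R (d%:R^-1) : RR) ^+ d = n%:R.
  by rewrite -powR_mulrn ?powR_ge0 // -powRrM mulVf ?powRr1 ?ler0n // pnatr_eq0 -lt0n.
have hM n L : (n0 <= n)%N -> 0 <= L -> L <= c * powR n%:R (d%:R^-1) ->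
    (Mk k d n L <= Tturan n A)%N.
  move=> nn L0 Lx; apply/bigmax_leqP => M /asboolP.
  by apply: (hc n (powR n%:R (d%:R^-1)) L M) => //; exact: powR_ge0.
split.
  (* For length 1 it suffices that [n] exceeds [c^-d], since then [c n^(1/d) >= 1]. *)
  exists (maxn n0 (Num.truncn (c ^- d)).+1) => n; rewrite geq_max => /andP[nn nc].
  split; last exact: Tturan_le.
  apply: hM => //; rewrite mulrC -ler_pdivrMr // div1r.
  rewrite -(ler_pXn2r d0) ?nnegrE ?invr_ge0 ?powR_ge0 ?(ltW c0) // xn exprVn.
  by apply: ltW; apply: lt_le_trans (truncnS_gt _) _; rewrite ler_nat.
exists c; split=> //; exists n0 => n nn; split; last exact: Tturan_le.
by apply: hM => //; rewrite mulr_ge0 ?powR_ge0 // ltW.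
Qed.
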